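(* Let $\lambda=(\lambda_1,\dots,\lambda_\ell)$ be a partition of length $\ell$, and let $\mathbf{x}=(x_1,\dots,x_n)$ and $\mathbf{t}=(t_1,\dots,t_{\ell-1})$ be commuting indeterminates. The partition function of the vertex model $\mathfrak{N}_\lambda$ with spectral parameters $\mathbf{x}\sqcup\mathbf{t}$ is the refined dual Grothendieck polynomial: $$Z(\mathfrak{N}_\lambda;\mathbf{x}\sqcup\mathbf{t})=g_\lambda(\mathbf{x};\mathbf{t}).$$
   Context: **Refined dual Grothendieck polynomial.** A reverse plane partition of shape $\lambda$ (English convention, row 1 at the top) is a filling of the boxes of $\lambda$ with positive integers that weakly increases along rows (left to right) and down columns. Let $\mathrm{RPP}^n(\lambda)$ be the set of those with all entries at most $n$. For $T\in\mathrm{RPP}^n(\lambda)$, let $a_i$ be the number of columns of $T$ containing $i$, and let $b_r$ be the number of boxes in row $r$ of $T$ whose entry equals the entry in the box directly below. Then $g_\lambda(\mathbf{x};\mathbf{t}):=\sum_{T\in\mathrm{RPP}^n(\lambda)}\prod_{r}t_r^{b_r}\prod_{i}x_i^{a_i}$. **The model $\mathfrak{N}_\lambda$.** It consists of vertices on left-aligned rows of a square grid. The bottom $n$ rows each have $\lambda_1+\ell$ vertices. For $i=2,\dots,\ell$, the $(n+i-1)$-th row from the bottom has $\lambda_i+\ell+1-i$ vertices. Columns are numbered $1,2,\dots$ from the left. Adjacent vertices are joined by edges, and each vertex has half-edges on the boundary where there is no neighbor. The $i$-th row from the bottom has spectral parameter $x_i$ for $1\le i\le n$, and the $(n+i)$-th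 row from the bottom has spectral parameter $t_i$ for $1\le i\le \ell-1$. Edges and half-edges are labeled by $0$ or $1$. Boundary conditions: all left and right boundary half-edges are labeled $0$; the bottom half-edges of the leftmost $\ell$ columns are labeled $1$ and the other bottom half-edges are labeled $0$; the top boundary half-edge of column $c$ (the half-edge above the topmost vertex of that column) is labeled $1$ if $c=\lambda_i+\ell+1-i$ for some $1\le i\le\ell$, and $0$ otherwise. **Boltzmann weights.** A vertex in a row with spectral parameter $z$ whose adjacent labels are (top, right, bottom, left) has weight: $(0,0,0,0)\mapsto 1$; $(1,0,1,0)\mapsto 1$; $(0,1,0,1)\mapsto z$; $(1,0,0,1)\mapsto z$; $(0,1,1,0)\mapsto 1$; and all other configurations have weight $0$. A state is a labeling of all edges compatible with the boundary conditions in which every vertex has non-zero weight. Its weight is the product of the weights of all its vertices, and the partition function $Z$ is the sum of the weights of all states. *)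

(* Defs.v *)
From HB Require Import structures.
From mathcomp Require Import all_boot all_order all_algebra.
From mathcomp Require Import mpoly.

Set Implicit Arguments.
Unset Strict Implicit.
Unset Printing Implicit Defensive.

Import GRing.Theory.

(* Parts, rows, columns and variables are numbered from 0: lambda_1 is         *)
(* [part lam 0], x_1 is [x ord0], t_1 is [t ord0].  The part of index i is 0   *)
(* when i >= size lam.                                                         *)

(* The length of the partition is [size lam]. *)
Definition is_partition (lam : seq nat) : bool :=
  sorted geq lam && (0 \notin lam).

Definition part (lam : seq nat) (i : nat) : nat := nth 0 lam i.

Section DualGrothendieck.

Variables (n : nat) (lam : seq nat).

Definition grid : finType := ('I_(size lam) * 'I_(part lam 0))%type.

Definition in_diagram (p : grid) : bool := p.2 < part lam p.1.

(* The entries are genuine values 1, ..., n; the value 0 marks the positions   *)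
(* outside the diagram, so that RPPs correspond to unique finite functions.    *)
Definition filling : finType := {ffun grid -> 'I_n.+1}.

Definition is_rpp (T : filling) : bool :=
  [&& [forall p, (0 < T p) == in_diagram p],
      [forall p, forall q, [&& in_diagram p, in_diagram q,
         p.1 == q.1 & p.2 <= q.2] ==> (T p <= T q)]
    & [forall p, forall q, [&& in_diagram p, in_diagram q,
         p.2 == q.2 & p.1 <= q.1] ==> (T p <= T q)]].

(* The variable of index i corresponds to the entry i.+1. *)
Definition columns_containing (T : filling) (i : 'I_n) : nat :=
  #|[set j : 'I_(part lam 0) |
      [exists p, [&& in_diagram p, p.2 == j & T p == i.+1 :> nat]]]|.

Definition equal_below (T : filling) (r : nat) : nat :=
  #|[set p : grid | [&& in_diagram p, p.1 == r :> nat &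
      [exists q, [&& in_diagram q, q.1 == p.1.+1 :> nat, q.2 == p.2 &
                     T q == T p]]]]|.

(* The last row has no box below it, hence contributes no t-variable. *)
Definition dual_grothendieck (R : comNzRingType)
    (x : 'I_n -> R) (t : 'I_(size lam).-1 -> R) : R :=
  (\sum_(T : filling | is_rpp T)
     (\prod_(r < (size lam).-1) t r ^+ equal_below T r) *
     (\prod_(i < n) x i ^+ columns_containing T i))%R.

End DualGrothendieck.

Definition vertex_weight (R : comNzRingType) (z : R)
    (top right bottom left : bool) : R :=
  (match top, right, bottom, left with
   | false, false, false, false => 1
   | true,  false, true,  false => 1
   | false, true,  false, true  => z
   | true,  false, false, true  => z
   | false, true,  true,  false => 1
   | _, _, _, _ => 0
   end)%R.

Section VertexModel.

Variables (n : nat) (lam : seq nat).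

(* Rows are counted from the bottom, columns from the left. *)
Definition nrows : nat := n + (size lam).-1.
Definition ncols : nat := part lam 0 + size lam.

(* For i = 2, ..., l the (n+i-1)-th row has lambda_i + l + 1 - i vertices; it  *)
(* is the row of index r = n + i - 2, so that i - 1 = r - n + 1.  If n = 0 the *)
(* last column has no vertex, and then carries a single edge, which is both    *)
(* its bottom and its top half-edge.                                           *)
Definition width (r : nat) : nat :=
  if r < n then part lam 0 + size lam
  else part lam (r - n).+1 + size lam - (r - n).+1.

Definition is_vertex (r c : nat) : bool := (r < nrows) && (c < width r).

(* Vertical (half-)edge (0, c) is the bottom half-edge of column c, and        *)
(* (r.+1, c) is the one above the vertex (r, c).  Since widths do not          *)
(* increase upwards, (r, c) is the one below the vertex (r, c).                 *)
Definition is_vedge (r c : nat) : bool :=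
  if r is r'.+1 then is_vertex r' c else c < ncols.

(* Horizontal (half-)edge (r, 0) is the left half-edge of row r, and (r, c.+1) *)
(* is the one to the right of the vertex (r, c).                               *)
Definition is_hedge (r c : nat) : bool :=
  if c is c'.+1 then is_vertex r c' else r < nrows.

(* Labels of the vertical and of the horizontal (half-)edges, true being 1;    *)
(* positions carrying no edge are given the junk value false (see is_labeling) *)
(* so that each labeling is counted once.                                      *)
Definition labeling : finType :=
  ({ffun 'I_nrows.+1 * 'I_ncols -> bool} *
   {ffun 'I_nrows * 'I_ncols.+1 -> bool})%type.

Definition is_labeling (s : labeling) : bool :=
  [forall r : 'I_nrows.+1, forall c : 'I_ncols,
     s.1 (r, c) ==> is_vedge r c] &&
  [forall r : 'I_nrows, forall c : 'I_ncols.+1,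
     s.2 (r, c) ==> is_hedge r c].

(* A right (resp. top) boundary half-edge is one with no vertex to its right   *)
(* (resp. above it).                                                           *)
Definition boundary_ok (s : labeling) : bool :=
  [&& [forall r, s.2 (r, ord0) == false],
      [forall r : 'I_nrows, forall c : 'I_ncols.+1,
         (is_hedge r c && ~~ is_vertex r c) ==>
         (s.2 (r, c) == false)],
      [forall c, s.1 (ord0, c) == (c < size lam)]
    & [forall r : 'I_nrows.+1, forall c : 'I_ncols,
         (is_vedge r c && ~~ is_vertex r c) ==>
         (s.1 (r, c) == [exists i : 'I_(size lam),
                           c.+1 == part lam i + size lam - i])]].

Section Weights.

Variables (R : comNzRingType) (x : 'I_n -> R) (t : 'I_(size lam).-1 -> R).

Definition spectral (r : 'I_nrows) : R :=
  match split r with inl i => x i | inr j => t j end.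

Definition weight_at (s : labeling) (v : 'I_nrows * 'I_ncols) : R :=
  let: (r, c) := v in
  vertex_weight (spectral r)
    (s.1 (lift ord0 r, c))
    (s.2 (r, lift ord0 c))
    (s.1 (widen_ord (leqnSn _) r, c))
    (s.2 (r, widen_ord (leqnSn _) c)).

Definition is_state (s : labeling) : bool :=
  [&& is_labeling s, boundary_ok s &
      [forall v : 'I_nrows * 'I_ncols,
         is_vertex v.1 v.2 ==> (weight_at s v != 0%R)]].

Definition state_weight (s : labeling) : R :=
  (\prod_(v : 'I_nrows * 'I_ncols | is_vertex v.1 v.2) weight_at s v)%R.

Definition partition_function : R :=
  (\sum_(s : labeling | is_state s) state_weight s)%R.

End Weights.

End VertexModel.

(* Main.v *)
Require Import Defs.
From mathcomp Require Import all_boot all_order all_algebra.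
From mathcomp Require Import mpoly zify ring.

Set Implicit Arguments.
Unset Strict Implicit.
Unset Printing Implicit Defensive.

Import GRing.Theory.

(* Both sides are sums over chains of partitions.  In the vertex model the     *)
(* particles on the vertical edges between two rows form a partition, and a    *)
(* row with parameter z adds a horizontal strip S with weight z^|S|; in the    *)
(* row with parameter t_k only the parts below the k-th one can still move.    *)
(* In an RPP the boxes with entries at most r form a partition, and the boxes  *)
(* with entry r form an arbitrary skew shape, with a weight in x_r and t that  *)
(* is a product over the rows.  Let T_k(z) be the transfer operator adding a   *)
(* strip below the first k rows, and let G_k(x) interpolate between G_0 = T_0  *)
(* and the RPP operator G_(l-1), the interlacing condition being dropped in    *)
(* the first k+1 rows.  A Bender-Knuth type exchange, row by row, gives        *)
(* G_k(x) T_(k+1)(t_(k+1)) = T_(k+1)(t_(k+1)) G_(k+1)(x), operators acting on  *)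
(* the right.  Hence T_1, ..., T_(l-1) move to the front, where they fix the   *)
(* empty partition.                                                            *)

(** The heart is [layer_strip_exchange]. Fix the outer shapes [a] and [c]. On both sides of the
    exchange each free part of the intermediate shape ranges over the same interval, independently
    of the other parts, so both sides factor over the rows. The sum over one interval is a monomial
    times a complete homogeneous polynomial in the two parameters, and the latter is symmetric. The
    monomials come from the overflows of row i+1 of [c] beyond row i of [a]; exchanging the
    parameters shifts these overflows by one row, and their products agree because the last overflow
    is zero and because G_(k+1) charges one new overflow to t_(k+1). [vertex_path_sum] iterates this
    relation.

    [partition_function_path_sum] identifies states with chains of strips: the vertical labels
    between two rows are the particles of a partition, conservation determines the horizontal
    labels, and each shortened row ends where the first particle still free in it has to stop, which
    freezes the particles to the right. [dual_grothendieck_path_sum] cuts an RPP into the shapes of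
    its entries at most r and reads both statistics row by row. *)

Lemma forall_ordP (l : nat) (P : pred nat) :
  reflect (forall i, i < l -> P i) [forall i : 'I_l, P i].
Proof.
apply: (iffP forallP) => [Pi i lt_il | Pi i]; last exact: Pi.
exact: (Pi (Ordinal lt_il)).
Qed.

Lemma prod_if (R : comNzRingType) (I : finType) (C : pred I) (F : I -> R) :
  (\prod_i (if C i then F i else 0) = if [forall i, C i] then \prod_i F i else 0)%R.
Proof.
case: forallP => [Ci | /forallP]; first by apply: eq_bigr => i _; rewrite Ci.
rewrite negb_forall => /existsP[i /negPf nCi].
by rewrite (bigD1 i) //= nCi mul0r.
Qed.

(** * Path sums of transfer kernels *)

Section PathSums.

Variables (R : comNzRingType) (S : finType).

(** A row vector times the matrix [K], so that operators compose in the order in which the rows are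
    stacked. *)
Definition act (K : S -> S -> R) (f : {ffun S -> R}) : {ffun S -> R} :=
  [ffun q => \sum_p f p * K p q]%R.

Definition delta (a : S) : {ffun S -> R} := [ffun p => (p == a)%:R]%R.

Fixpoint path_sum (K : nat -> S -> S -> R) (a : S) (k : nat) : {ffun S -> R} :=
  if k is k'.+1 then act (K k') (path_sum K a k') else delta a.

(** An entry of a product of matrices is a sum over walks; the induction splits off the endpoint of
    the walk. *)
Lemma path_sumE (K : nat -> S -> S -> R) (a b : S) (k : nat) :
  (path_sum K a k b =
   \sum_(Q : {ffun 'I_k.+1 -> S} | (Q ord0 == a) && (Q ord_max == b))
     \prod_(r < k) K r (Q (widen_ord (leqnSn k) r)) (Q (lift ord0 r)))%R.
Proof.
elim: k b => [|k IHk] b /=.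
  rewrite ffunE; case: eqP => [-> | neq_ba].
    rewrite (big_pred1 [ffun=> a]) => [|Q]; first by rewrite big_ord0.
    rewrite /= (_ : ord_max = ord0) ?andbb; last exact/val_inj.
    apply/eqP/eqP => [Qa | ->]; last by rewrite ffunE.
    by apply/ffunP => i; rewrite ffunE ord1.
  rewrite big1 // => Q /andP[/eqP Qa /eqP Qb].
  by case: neq_ba; rewrite -Qa -Qb; congr (Q _); apply: val_inj.
pose snoc (u : S * {ffun 'I_k.+1 -> S}) : {ffun 'I_k.+2 -> S} :=
  [ffun i => if unlift ord_max i is Some j then u.2 j else u.1].
pose split_last (Q : {ffun 'I_k.+2 -> S}) :=
  (Q ord_max, [ffun j => Q (lift ord_max j)] : {ffun 'I_k.+1 -> S}).
have snocK : cancel snoc split_last.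
  case=> c Q; rewrite /split_last /snoc ffunE unlift_none /=; congr pair.
  by apply/ffunP => j; rewrite !ffunE liftK.
have splitK : cancel split_last snoc.
  move=> Q; apply/ffunP => i; rewrite ffunE.
  by case: unliftP => [j ->|->]; rewrite ?ffunE.
rewrite [RHS](reindex snoc); last by exists split_last.
rewrite ffunE.
rewrite (eq_bigr _ (fun p _ => congr1 (fun u => u * K k p b)%R (IHk p))).
under eq_bigr => p _ do rewrite mulr_suml.
have lift0 (u : S * {ffun 'I_k.+1 -> S}) : snoc u ord0 = u.2 ord0.
  rewrite ffunE (_ : ord0 = lift ord_max (ord0 : 'I_k.+1)) ?liftK //.
  exact: val_inj.
have liftm (u : S * {ffun 'I_k.+1 -> S}) : snoc u ord_max = u.1.
  by rewrite ffunE unlift_none.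
under [RHS]eq_bigl => u do rewrite lift0 liftm.
rewrite (exchange_big_dep (fun Q : {ffun 'I_k.+1 -> S} => Q ord0 == a)) /=;
  last by move=> p Q _ /andP[].
pose F (c : S) (Q : {ffun 'I_k.+1 -> S}) : R :=
  (\prod_(r < k.+1) K r (snoc (c, Q) (widen_ord (leqnSn k.+1) r))
     (snoc (c, Q) (lift ord0 r)))%R.
transitivity (\sum_(Q : {ffun 'I_k.+1 -> S} | Q ord0 == a) F b Q)%R.
  (* The intermediate vertex [p] is forced to be the endpoint of the shorter walk. *)
  apply: eq_bigr => Q Qa; rewrite (big_pred1 (Q ord_max)) => [|p]; last first.
    by rewrite /= Qa /= eq_sym.
  rewrite /F big_ord_recr /=; congr (_ * _)%R.
    apply: eq_bigr => r _; congr (K r _ _); rewrite ffunE.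
      rewrite (_ : widen_ord _ _ = lift ord_max (widen_ord (leqnSn k) r)) ?liftK //.
      by apply: val_inj; rewrite /= /bump leqNgt ltnS ltnW.
    rewrite (_ : lift ord0 _ = lift ord_max (lift ord0 r)) ?liftK //.
    by apply: val_inj; rewrite /= /bump /= leqNgt ltnS ltn_ord.
  congr (K k _ _); rewrite ffunE.
    rewrite (_ : widen_ord _ _ = lift ord_max (ord_max : 'I_k.+1)) ?liftK //.
    by apply: val_inj; rewrite /= /bump leqNgt ltnS leqnn.
  by rewrite (_ : lift ord0 _ = ord_max) ?unlift_none //; apply: val_inj.
under eq_bigl => u do rewrite andbC.
rewrite -[RHS](pair_big (fun c => c == b) (fun Q : {ffun 'I_k.+1 -> S} => Q ord0 == a) F).
by rewrite big_pred1_eq.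
Qed.

End PathSums.

(** * Exchange of strips and layers *)

(* At most l parts, each at most m; the parts are not required to decrease. *)
Definition boxed_shape (l m : nat) : finType := {ffun 'I_l -> 'I_m.+1}.

Definition part_of (l m : nat) (p : boxed_shape l m) (i : nat) : nat :=
  if insub i is Some j then p j else 0.

Lemma part_of_ord (l m : nat) (p : boxed_shape l m) (i : 'I_l) : part_of p i = p i.
Proof. by rewrite /part_of valK. Qed.

Lemma part_of_out (l m : nat) (p : boxed_shape l m) (i : nat) :
  l <= i -> part_of p i = 0.
Proof. by move=> le_li; rewrite /part_of insubN // -leqNgt. Qed.

Lemma part_of_le (l m : nat) (p : boxed_shape l m) (i : nat) : part_of p i <= m.
Proof. by rewrite /part_of; case: insub => // j; rewrite -ltnS. Qed.

Lemma boxed_eq (l m : nat) (p q : boxed_shape l m) :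
  (forall i, i < l -> part_of p i = part_of q i) -> p = q.
Proof.
by move=> pq; apply/ffunP => i; apply: val_inj; rewrite /= -!part_of_ord pq.
Qed.

Section Kernels.

Variables (R : comNzRingType) (l m : nat).
Implicit Types (p q : boxed_shape l m) (i j k : nat) (x z : R) (t : nat -> R).

(** Interlacing with the first [k] parts frozen; [k] is positive exactly for the rows with a [t]
    parameter. *)
Definition horizontal_strip k p q : bool :=
  [forall i : 'I_l, if i < k then part_of q i == part_of p i
   else (part_of p i <= part_of q i) && ((0 < i) ==> (part_of q i <= part_of p i.-1))].

Lemma horizontal_stripP k p q :
  reflect (forall i, i < l -> if i < k then part_of q i == part_of p i
   else (part_of p i <= part_of q i) && ((0 < i) ==> (part_of q i <= part_of p i.-1)))
   (horizontal_strip k p q).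
Proof.
exact: (forall_ordP l (fun i => if i < k then part_of q i == part_of p i
   else (part_of p i <= part_of q i) && ((0 < i) ==> (part_of q i <= part_of p i.-1)))).
Qed.

Definition strip_kernel k z p q : R :=
  (if horizontal_strip k p q
   then \prod_(i < l) z ^+ (part_of q i - part_of p i) else 0)%R.

(* The interpolating operator G_k: within rows 0, ..., k the added boxes may lie
   one below another. *)
Definition layer k p q : bool :=
  [forall i : 'I_l, (part_of p i <= part_of q i) &&
     ((0 < i) ==> (part_of q i <= if i <= k then part_of q i.-1 else part_of p i.-1))].

Lemma layerP k p q :
  reflect (forall i, i < l -> (part_of p i <= part_of q i) &&
     ((0 < i) ==> (part_of q i <= if i <= k then part_of q i.-1 else part_of p i.-1)))
   (layer k p q).
Proof.
exact: (forall_ordP l (fun i => (part_of p i <= part_of q i) &&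
     ((0 < i) ==> (part_of q i <= if i <= k then part_of q i.-1 else part_of p i.-1)))).
Qed.

(* The truncated subtractions count the added boxes of row i with no added box
   directly above them (exponent of x) and those with one (exponent of t). *)
Definition layer_factor t x p q i : R :=
  (if i is j.+1 then
     x ^+ (minn (part_of q i) (part_of p j) - part_of p i) *
     t j ^+ (part_of q i - part_of p j)
   else x ^+ (part_of q 0 - part_of p 0))%R.

Definition layer_kernel t k x p q : R :=
  (if layer k p q then \prod_(i < l) layer_factor t x p q i else 0)%R.

(** With full interlacing no added box lies below another one, so every exponent of [t] vanishes. *)
Lemma layer_kernel0 t x p q : layer_kernel t 0 x p q = strip_kernel 0 x p q.
Proof.
rewrite /layer_kernel /strip_kernel (_ : layer 0 p q = horizontal_strip 0 p q).
  case: ifP => // /horizontal_stripP st; apply: eq_bigr => -[[|i] lt_il] _ //=.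
  move: (st _ lt_il) => /= /andP[_ le_q].
  by rewrite (minn_idPl le_q) (eqP (le_q : _ - _ == 0)) expr0 mulr1.
by apply: eq_forallb => i /=; case: (nat_of_ord i) => [|j]; rewrite //= ltn0.
Qed.

(** Splits off the monomial that depends on the ends only; for a nonempty interval, what remains is
    the complete homogeneous polynomial of degree [hi - lo] in [x] and [z]. *)
Lemma shifted_sum (x z : R) (lo hi a c : nat) :
  a <= lo -> hi <= c -> hi <= m ->
  (\sum_(b < m.+1 | (lo <= b <= hi)%N) x ^+ (b - a) * z ^+ (c - b) =
   x ^+ (lo - a) * z ^+ (c - hi) *
   \sum_(b < m.+1 | (lo <= b <= hi)%N) x ^+ (b - lo) * z ^+ (hi - b))%R.
Proof.
move=> le_al le_hc le_hm; rewrite mulr_sumr; apply: eq_bigr => b /andP[lob bhi].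
have -> : b - a = (lo - a) + (b - lo) by lia.
have -> : c - b = (c - hi) + (hi - b) by lia.
by rewrite !exprD; ring.
Qed.

(** The reflection [b -> lo + hi - b] of the interval exchanges the two exponents; this is the
    Bender-Knuth involution on one row. *)
Lemma complete_sum_sym (x z : R) (lo hi : nat) : hi <= m ->
  (\sum_(b < m.+1 | (lo <= b <= hi)%N) x ^+ (b - lo) * z ^+ (hi - b) =
   \sum_(b < m.+1 | (lo <= b <= hi)%N) z ^+ (b - lo) * x ^+ (hi - b))%R.
Proof.
move=> le_hm; pose flip (b : 'I_m.+1) : 'I_m.+1 := inord (lo + hi - b).
have flipE (b : 'I_m.+1) : lo <= b <= hi -> flip b = lo + hi - b :> nat.
  by move=> bP; rewrite inordK //; lia.
rewrite (reindex_onto flip flip) => [|b bP]; last first.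
  by apply: val_inj; rewrite /= flipE ?flipE //; lia.
apply: eq_big => [b | b /andP[bP /eqP fbK]].
  apply/andP/idP => [[bP /eqP fbK] | bP].
    by rewrite -fbK flipE //; lia.
  by split; [rewrite flipE //; lia | apply/eqP/val_inj; rewrite /= flipE ?flipE //; lia].
have {fbK} bP' : lo <= b <= hi by rewrite -fbK flipE //; lia.
rewrite flipE //.
have -> : lo + hi - b - lo = hi - b by lia.
have -> : hi - (lo + hi - b) = b - lo by lia.
by rewrite mulrC.
Qed.

(** Distributivity over the rows. It is available because [boxed_shape] is a full product, with no
    monotonicity built in. *)
Lemma sum_boxed (C : nat -> pred nat) (F : nat -> nat -> R) :
  (\sum_(b : boxed_shape l m | [forall i : 'I_l, C i (part_of b i)])
     \prod_(i < l) F i (part_of b i) =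
   \prod_(i < l) \sum_(j < m.+1 | C i j) F i j)%R.
Proof.
rewrite (bigA_distr_big_dep _ (fun (i : 'I_l) (j : 'I_m.+1) => F i j)) /=.
apply: eq_big => [b | b _]; last by apply: eq_bigr => i _; rewrite part_of_ord.
by apply: eq_forallb => i; rewrite part_of_ord.
Qed.

End Kernels.

Ltac if_lia := repeat (let h := fresh in case: ifP => h); lia.

(** * The exchange relation between a layer and a strip *)

Section Exchange.

Variables (R : comNzRingType) (l m : nat).
Implicit Types (p q : boxed_shape l m).
Variables (x : R) (t : nat -> R) (k : nat).
Hypothesis lt_kl : k.+1 < l.

(** Both products collect the same powers up to a shift of the index by one; the extra factor on
    each side corrects the last row and becomes 1 once [d N.-1] is zero. *)
Lemma telescoping_prod (z : R) (d : nat -> nat) (N : nat) :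
  (k.+1 < N)%N ->
  ((\prod_(i < N) if (i <= k)%N then 1 else x ^+ d i * z ^+ d i.-1) * z ^+ d N.-1 =
   (\prod_(i < N) if (i <= k)%N then 1 else
      z ^+ d i * (if i == k.+1 :> nat then z ^+ d k else x ^+ d i.-1)) * x ^+ d N.-1)%R.
Proof.
elim: N => // N IHN; rewrite ltnS leq_eqVlt => /predU1P[<- | lt_kN].
  rewrite !big_ord_recr /= ltnn eqxx.
  rewrite !big1 => [|i _|i _]; rewrite ?(ltnW (ltn_ord i)) //.
  by rewrite leqnn; ring.
rewrite !big_ord_recr /= leqNgt (ltnW lt_kN) /=.
rewrite (_ : N == k.+1 = false); last by apply: gtn_eqF.
have := IHN lt_kN.
set L := (\prod_(i < N) _)%R; set L' := (\prod_(i < N) _)%R => IH.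
transitivity (x ^+ d N * z ^+ d N * (L * z ^+ d N.-1))%R; first by ring.
by rewrite IH; ring.
Qed.

Variables a c : boxed_shape l m.

(* The range of the i-th part, i > k, of a shape between a and c.  It is the same
   on both sides of the exchange, so that both sums factor over the rows. *)
Let lo i := maxn (part_of a i) (part_of c i.+1).
Let hi i := minn (part_of a i.-1) (part_of c i).

(** The constraints that do not involve the intermediate shape. *)
Let outer : bool := [forall i : 'I_l,
  ((i <= k) ==> (part_of a i <= part_of c i)) &&
  ((0 < i <= k.+1) ==> (part_of c i <= part_of c i.-1))].

Let outerP := forall_ordP l (fun i =>
  ((i <= k) ==> (part_of a i <= part_of c i)) &&
  ((0 < i <= k.+1) ==> (part_of c i <= part_of c i.-1))).

(** The strip freezes the rows up to [k], so there [b] agrees with [e], which is [c] when the strip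
    comes second and [a] when it comes first. *)
Let middle (e : boxed_shape l m) (b : boxed_shape l m) : bool := [forall i : 'I_l,
  if i <= k then part_of b i == part_of e i else lo i <= part_of b i <= hi i].

Let middleP (e b : boxed_shape l m) := forall_ordP l (fun i =>
  if i <= k then part_of b i == part_of e i else lo i <= part_of b i <= hi i).

Lemma layer_stripE b :
  layer k a b && horizontal_strip k.+1 b c = outer && middle c b.
Proof.
apply/andP/andP => [[/layerP ab /horizontal_stripP bc] | [/outerP oc /middleP mb]].
  split.
    apply/outerP => i lt_il; have := ab i lt_il; have := bc i lt_il.
    case: i lt_il => [|i] lt_il /=; first by if_lia.
    have := bc i (ltnW lt_il); have := ab i (ltnW lt_il).
    if_lia.
  apply/middleP => i lt_il; have := ab i lt_il; have := bc i lt_il.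
  rewrite /lo /hi; case: (leqP i k) => ik; first by if_lia.
  have [lt_iSl|le_lSi] := ltnP i.+1 l.
    have := bc i.+1 lt_iSl; case: i ik {lt_il lt_iSl} => //= i ik; if_lia.
  by rewrite (part_of_out c le_lSi); case: i ik {lt_il le_lSi} => //= i ik; if_lia.
split.
  apply/layerP => i lt_il; have := oc i lt_il; have := mb i lt_il.
  rewrite /lo /hi; case: i lt_il => [|i] lt_il /=; first by if_lia.
  have := mb i (ltnW lt_il); rewrite /lo /hi.
  if_lia.
apply/horizontal_stripP => i lt_il; have := oc i lt_il; have := mb i lt_il.
rewrite /lo /hi; case: i lt_il => [|i] lt_il /=; first by if_lia.
have := mb i (ltnW lt_il); rewrite /lo /hi.
if_lia.
Qed.

Lemma strip_layerE b :
  horizontal_strip k.+1 a b && layer k.+1 b c = outer && middle a b.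
Proof.
apply/andP/andP => [[/horizontal_stripP ab /layerP bc] | [/outerP oc /middleP mb]].
  split.
    apply/outerP => i lt_il; have := ab i lt_il; have := bc i lt_il.
    case: i lt_il => [|i] lt_il /=; first by if_lia.
    have := bc i (ltnW lt_il); have := ab i (ltnW lt_il).
    if_lia.
  apply/middleP => i lt_il; have := ab i lt_il; have := bc i lt_il.
  rewrite /lo /hi; case: (leqP i k) => ik; first by if_lia.
  have [lt_iSl|le_lSi] := ltnP i.+1 l.
    have := bc i.+1 lt_iSl; have := ab i.-1 (leq_ltn_trans (leq_pred i) lt_il).
    case: i ik {lt_il lt_iSl} => //= i ik; if_lia.
  rewrite (part_of_out c le_lSi).
  have := ab i.-1 (leq_ltn_trans (leq_pred i) lt_il).
  by case: i ik {lt_il le_lSi} => //= i ik; if_lia.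
split.
  apply/horizontal_stripP => i lt_il; have := mb i lt_il.
  rewrite /lo /hi; case: i lt_il => [|i] lt_il /=; first by if_lia.
  if_lia.
apply/layerP => i lt_il; have := oc i lt_il; have := mb i lt_il.
rewrite /lo /hi; case: i lt_il => [|i] lt_il /=; first by if_lia.
have := mb i (ltnW lt_il); rewrite /lo /hi.
if_lia.
Qed.

Lemma prod_layer_strip b : middle c b ->
  ((\prod_(i < l) layer_factor t x a b i) *
   (\prod_(i < l) t k ^+ (part_of c i - part_of b i)) =
   \prod_(i < l) if (i <= k)%N then layer_factor t x a c i
     else x ^+ (part_of b i - part_of a i) * t k ^+ (part_of c i - part_of b i))%R.
Proof.
move=> /middleP mb; rewrite -big_split; apply: eq_bigr => -[i lt_il] _ /=.
have := mb i lt_il; rewrite /lo /hi; case: (leqP i k) => ik.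
  move=> /eqP bc; rewrite bc subnn expr0 mulr1.
  case: i {lt_il} ik bc => [|i] ik bc /=; by rewrite bc.
case: i lt_il ik => // i lt_il ik /= bP.
have -> : minn (part_of b i.+1) (part_of a i) = part_of b i.+1 by lia.
have -> : part_of b i.+1 - part_of a i = 0 by lia.
by rewrite expr0 mulr1.
Qed.

(** Row [k.+1] is the exception: [layer k.+1] lets it extend beyond row [k] of [b], which is row [k]
    of [a], and the excess is paid with [t k]. In later rows interlacing excludes such an excess. *)
Lemma prod_strip_layer b : middle a b ->
  ((\prod_(i < l) t k ^+ (part_of b i - part_of a i)) *
   (\prod_(i < l) layer_factor t x b c i) =
   \prod_(i < l) if (i <= k)%N then layer_factor t x a c i
     else t k ^+ (part_of b i - part_of a i) *
       (if i == k.+1 :> nat then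
          x ^+ (hi i - part_of b i) * t k ^+ (part_of c k.+1 - part_of a k)
        else x ^+ (part_of c i - part_of b i)))%R.
Proof.
move=> /middleP mb; rewrite -big_split; apply: eq_bigr => -[i lt_il] _ /=.
have := mb i lt_il; case: (leqP i k) => ik.
  move=> /eqP bc; rewrite bc subnn expr0 mul1r.
  case: i lt_il ik bc => [|i] lt_il ik bc /=; rewrite ?bc //.
  by have := mb i (ltnW lt_il); rewrite (ltnW ik) => /eqP ->.
case: i lt_il ik => // i lt_il ik bP; congr (_ * _)%R => /=.
have := mb i (ltnW lt_il); rewrite eqSS; case: (i =P k) => [ik' | ik'].
  by rewrite ik' leqnn /hi /= => /eqP ->; rewrite minnC.
have -> : i <= k = false by lia.
move: bP; rewrite /lo /hi /= => bP bP'.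
have -> : minn (part_of c i.+1) (part_of b i) = part_of c i.+1 by lia.
have -> : part_of c i.+1 - part_of b i = 0 by lia.
by rewrite expr0 mulr1.
Qed.

Lemma layer_strip_exchange :
  (\sum_b layer_kernel t k x a b * strip_kernel k.+1 (t k) b c =
   \sum_b strip_kernel k.+1 (t k) a b * layer_kernel t k.+1 x b c)%R.
Proof.
pose h i := (\sum_(j < m.+1 | (lo i <= j <= hi i)%N)
  x ^+ (j - lo i) * t k ^+ (hi i - j))%R.
pose d i := part_of c i.+1 - part_of a i.
have hi_le i : hi i <= m by rewrite geq_min part_of_le.
have lo_sub i : lo i - part_of a i = d i by rewrite /lo /d; lia.
have hi_sub i : 0 < i -> part_of c i - hi i = d i.-1.
  by case: i => // i _; rewrite /hi /d /=; lia.
have le_lo i : part_of a i <= lo i by rewrite leq_maxl.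
have le_hi i : hi i <= part_of c i by rewrite geq_minr.
have at_row (e : boxed_shape l m) i (le_ik : i <= k) (F : nat -> R) :
    (\sum_(j < m.+1 | (if (i <= k)%N then j == part_of e i :> nat else (lo i <= j <= hi i)%N)) F j
     = F (part_of e i))%R.
  rewrite le_ik.
  have lt_em : part_of e i < m.+1 by rewrite ltnS part_of_le.
  by rewrite (big_pred1 (Ordinal lt_em)).
transitivity (if outer then
   \prod_(i < l) ((if (i <= k)%N then layer_factor t x a c i else h i) *
     (if (i <= k)%N then 1 else x ^+ d i * t k ^+ d i.-1)) else 0)%R.
  transitivity (\sum_b if outer && middle c b then
    \prod_(i < l) if (i <= k)%N then layer_factor t x a c i
     else x ^+ (part_of b i - part_of a i) * t k ^+ (part_of c i - part_of b i)
    else 0)%R.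
    apply: eq_bigr => b _; rewrite /layer_kernel /strip_kernel -layer_stripE.
    case: ifP => // lab; case: ifP => // sbc; rewrite ?mulr0 ?mul0r //=.
    rewrite prod_layer_strip //.
    by have := layer_stripE b; rewrite lab sbc => /esym/andP[].
  case: outer; last by rewrite big1.
  rewrite -big_mkcond /= (sum_boxed l m
    (fun i v => if i <= k then v == part_of c i else lo i <= v <= hi i)
    (fun i v => if (i <= k)%N then layer_factor t x a c i
     else x ^+ (v - part_of a i) * t k ^+ (part_of c i - v))%R).
  apply: eq_bigr => i _; case: (leqP i k) => ik.
    by rewrite mulr1 -[RHS](at_row c i ik (fun=> layer_factor t x a c i)) ik.
  rewrite shifted_sum // lo_sub hi_sub; last by lia.
  by rewrite mulrC.
transitivity (if outer then
   \prod_(i < l) ((if (i <= k)%N then layer_factor t x a c i else h i) *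
     (if (i <= k)%N then 1 else
      t k ^+ d i * (if i == k.+1 :> nat then t k ^+ d k else x ^+ d i.-1))) else 0)%R.
  case: outer => //; rewrite !big_split; congr (_ * _)%R.
  have := telescoping_prod (t k) d lt_kl.
  (* Row [l] of [c] is empty, so nothing overflows from it. *)
  have -> : d l.-1 = 0.
    by rewrite /d part_of_out //; lia.
  by rewrite !mulr1.
transitivity (\sum_b if outer && middle a b then
    \prod_(i < l) if (i <= k)%N then layer_factor t x a c i
     else t k ^+ (part_of b i - part_of a i) *
       (if i == k.+1 :> nat then
          x ^+ (hi i - part_of b i) * t k ^+ (part_of c k.+1 - part_of a k)
        else x ^+ (part_of c i - part_of b i))
    else 0)%R; last first.
  apply: eq_bigr => b _; symmetry; rewrite /layer_kernel /strip_kernel -strip_layerE.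
  case: ifP => // sab; case: ifP => // lbc; rewrite ?mulr0 ?mul0r //=.
  rewrite prod_strip_layer //.
  by have := strip_layerE b; rewrite sab lbc => /esym/andP[].
case: outer; last by rewrite big1.
rewrite -big_mkcond /= (sum_boxed l m
    (fun i v => if i <= k then v == part_of a i else lo i <= v <= hi i)
    (fun i v => if (i <= k)%N then layer_factor t x a c i
     else t k ^+ (v - part_of a i) *
       (if i == k.+1 :> nat then
          x ^+ (hi i - v) * t k ^+ (part_of c k.+1 - part_of a k)
        else x ^+ (part_of c i - v)))%R).
apply: eq_bigr => i _; case: (leqP i k) => ik.
  by rewrite mulr1 -[LHS](at_row a i ik (fun=> layer_factor t x a c i)) ik.
(* The symmetry enters here: it exchanges [x] and [t k] inside the sum [h i]. *)
rewrite /h complete_sum_sym //; case: eqP => [ik' | ik'].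
  transitivity ((\sum_(j < m.+1 | (lo i <= j <= hi i)%N)
    t k ^+ (j - part_of a i) * x ^+ (hi i - j)) * t k ^+ d k)%R.
    by rewrite [X in (_ = X * _)%R]shifted_sum // subnn expr0 lo_sub; ring.
  by rewrite mulr_suml; apply: eq_bigr => j _; rewrite mulrA.
by rewrite [RHS]shifted_sum // lo_sub hi_sub; [rewrite mulrC | lia].
Qed.

End Exchange.

(** * Moving all frozen strips to the front *)

Section Commutation.

Variables (R : comNzRingType) (l m : nat) (t : nat -> R).
Implicit Types (f : {ffun boxed_shape l m -> R}) (x : nat -> R).

Definition empty_shape : boxed_shape l m := [ffun=> ord0].

Lemma part_of_empty i : part_of empty_shape i = 0.
Proof. by rewrite /part_of; case: insub => // j; rewrite ffunE. Qed.

Fixpoint strips (j : nat) f : {ffun boxed_shape l m -> R} :=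
  if j is j'.+1 then act (@strip_kernel R l m j (t j')) (strips j' f) else f.

Lemma act_act (K K' : boxed_shape l m -> boxed_shape l m -> R) f :
  act K' (act K f) = [ffun q => \sum_p f p * \sum_b K p b * K' b q]%R.
Proof.
apply/ffunP => q; rewrite !ffunE.
under eq_bigr => b _ do rewrite ffunE mulr_suml.
rewrite exchange_big; apply: eq_bigr => p _ /=.
by rewrite mulr_sumr; apply: eq_bigr => b _; rewrite mulrA.
Qed.

(** Each strip that passes the layer raises the index of the layer by one, so the indices of strip
    and layer always match in the exchange. *)
Lemma strips_layer (y : R) (j : nat) f : j <= l.-1 ->
  strips j (act (layer_kernel t 0 y) f) = act (layer_kernel t j y) (strips j f).
Proof.
elim: j => // j IHj le_jl /=; rewrite IHj; last by lia.
rewrite !act_act; apply/ffunP => q; rewrite !ffunE; apply: eq_bigr => p _.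
by rewrite layer_strip_exchange //; lia.
Qed.

(** Only the first row of the empty shape could grow, and it is frozen as soon as [k] is
    positive. *)
Lemma strip_from_empty (k : nat) (z : R) (q : boxed_shape l m) : 0 < k ->
  strip_kernel k z empty_shape q = ((q == empty_shape)%:R)%R.
Proof.
move=> k_gt0; rewrite /strip_kernel; case: eqP => [-> | neq_q].
  rewrite (_ : horizontal_strip _ _ _ = true); last first.
    by apply/horizontal_stripP => i lt_il; rewrite !part_of_empty; if_lia.
  by rewrite big1 // => i _; rewrite subnn.
case: horizontal_stripP => // strip_q; case: neq_q.
apply: boxed_eq => i lt_il; have := strip_q i lt_il; rewrite !part_of_empty; if_lia.
Qed.

Lemma strips_delta (j : nat) :
  strips j (delta R empty_shape) = delta R empty_shape.
Proof.
elim: j => //= j ->; apply/ffunP => q; rewrite !ffunE.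
rewrite (bigD1 empty_shape) //= big1 => [|p /negPf neq_p].
  by rewrite ffunE eqxx mul1r addr0 strip_from_empty.
by rewrite ffunE neq_p mul0r.
Qed.

Lemma strips_path_sum (j n : nat) x : j <= l.-1 ->
  strips j (path_sum (fun r => strip_kernel 0 (x r)) empty_shape n) =
  path_sum (fun r => layer_kernel t j (x r)) empty_shape n.
Proof.
move=> le_jl; elim: n => [|n IHn] /=; first exact: strips_delta.
rewrite -IHn -strips_layer //; congr (strips j _).
by apply/ffunP => q; rewrite !ffunE; apply: eq_bigr => p _; rewrite layer_kernel0.
Qed.

Definition vertex_kernel (n : nat) x (r : nat) : boxed_shape l m -> boxed_shape l m -> R :=
  if r < n then strip_kernel 0 (x r) else strip_kernel (r - n).+1 (t (r - n)).

(** The [n] unfrozen strips are layers of index 0; the [l.-1] frozen strips above them turn them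
    into layers of index [l.-1] and then act trivially on the empty shape. *)
Lemma vertex_path_sum (n : nat) x :
  path_sum (vertex_kernel n x) empty_shape (n + l.-1) =
  path_sum (fun r => layer_kernel t l.-1 (x r)) empty_shape n.
Proof.
rewrite -strips_path_sum //; elim: l.-1 => [|j IHj] /=.
  rewrite addn0.
  suff eq_path r : r <= n -> path_sum (vertex_kernel n x) empty_shape r =
      path_sum (fun r => strip_kernel 0 (x r)) empty_shape r by apply: eq_path.
  by elim: r => //= r IHr lt_rn; rewrite IHr 1?ltnW // /vertex_kernel lt_rn.
rewrite addnS /= IHj /vertex_kernel; congr act.
by rewrite ltnNge leq_addr /= addKn.
Qed.

End Commutation.

(** * Reverse plane partitions as chains of layers *)

Lemma downset_count_le (P : pred nat) (N : nat) : \sum_(k < N) P k <= N.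
Proof.
rewrite -[X in _ <= X](card_ord N) -sum1_card.
by apply: leq_sum => k _; apply: leq_b1.
Qed.

(** A down-set of naturals is an initial segment, so its size is the threshold of membership. This
    converts between entries, parts and particle counts. *)
Lemma downset_count (P : pred nat) (N : nat) :
  (forall a b, a <= b -> b < N -> P b -> P a) ->
  forall r, r < N -> (r < \sum_(k < N) P k) = P r.
Proof.
elim: N => // N IHN downP r; rewrite ltnS big_ord_recr /= => le_rN.
have downP' a b : a <= b -> b < N -> P b -> P a by move=> ab /ltnW; apply: downP.
case PN: (P N).
  rewrite (downP _ _ le_rN) // (eq_bigr (fun=> 1)) => [|k _]; last first.
    by rewrite (downP _ _ (ltnW (ltn_ord k))).
  by rewrite sum1_card card_ord addn1 ltnS.
rewrite addn0; have [lt_rN | le_Nr] := ltnP r N; first exact: IHN.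
have -> : r = N by lia.
by rewrite PN ltnNge downset_count_le.
Qed.

Lemma leq_below (M a b : nat) : a <= M ->
  (forall j, j < M -> j < a -> j < b) -> a <= b.
Proof.
move=> aM ab; case: (leqP a b) => // lt_ba.
by have := ab b (leq_trans lt_ba aM) lt_ba; rewrite ltnn.
Qed.

Lemma count_interval (M a b : nat) : b <= M ->
  \sum_(j < M) (a <= j < b : nat) = b - a.
Proof.
elim: M a b => [|M IHM] a b; first by rewrite leqn0 => /eqP->; rewrite big_ord0.
rewrite leq_eqVlt => /predU1P[-> | lt_bM].
  rewrite big_ord_recr /= ltnSn andbT.
  rewrite (eq_bigr (fun j : 'I_M => (a <= j < M) : nat)) => [|j _]; last first.
    by rewrite ltn_ord ltnS (ltnW (ltn_ord j)).
  by rewrite IHM //; case: leqP; lia.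
by rewrite big_ord_recr /= IHM //; lia.
Qed.

Section Partitions.

Variables (lam : seq nat) (lam_part : is_partition lam).

Definition lam_shape : boxed_shape (size lam) (part lam 0) :=
  [ffun i : 'I_(size lam) => inord (part lam i)].

Lemma part_decr i j : i <= j -> part lam j <= part lam i.
Proof.
move=> le_ij; have [lt_jl | le_lj] := ltnP j (size lam); last first.
  by rewrite /part nth_default.
case/andP: lam_part => sl _.
by apply: (sorted_leq_nth _ _ 0 sl); rewrite ?inE //; try exact: leq_ltn_trans lt_jl;
   [move=> a b c ba ac; apply: leq_trans ac ba | apply: leqnn].
Qed.

Lemma part_of_lam i : part_of lam_shape i = part lam i.
Proof.
have [lt_il | le_li] := ltnP i (size lam); last first.
  by rewrite part_of_out // /part nth_default.
rewrite -[i]/(nat_of_ord (Ordinal lt_il)) part_of_ord ffunE inordK // ltnS.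
exact: part_decr.
Qed.

End Partitions.

Section Chains.

Variables (l m N : nat) (Q : {ffun 'I_N.+1 -> boxed_shape l m}).

(** Indexing by naturals avoids casts between ordinals; it is meaningful for [r <= N], where [inord]
    is faithful. *)
Definition part_at (r i : nat) : nat := part_of (Q (inord r)) i.

Lemma part_at_widen (r : 'I_N) i :
  part_of (Q (widen_ord (leqnSn N) r)) i = part_at r i.
Proof.
congr (part_of (Q _) i); apply: val_inj.
by rewrite /= inordK // ltnS ltnW.
Qed.

Lemma part_at_lift (r : 'I_N) i : part_of (Q (lift ord0 r)) i = part_at r.+1 i.
Proof.
congr (part_of (Q _) i); apply: val_inj.
by rewrite /= inordK // ltnS.
Qed.

Lemma part_at_ord0 i : part_of (Q ord0) i = part_at 0 i.
Proof. by congr (part_of (Q _) i); apply: val_inj; rewrite /= inordK. Qed.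

Lemma part_at_max i : part_of (Q ord_max) i = part_at N i.
Proof. by congr (part_of (Q _) i); apply: val_inj; rewrite /= inordK. Qed.

Lemma part_at_ord (r : 'I_N.+1) i : part_of (Q r) i = part_at r i.
Proof. by rewrite /part_at inord_val. Qed.

Lemma part_at_le r i : part_at r i <= m.
Proof. exact: part_of_le. Qed.

Lemma part_at_out r i : l <= i -> part_at r i = 0.
Proof. exact: part_of_out. Qed.

End Chains.

Lemma chain_eq (l m N : nat) (Q Q' : {ffun 'I_N.+1 -> boxed_shape l m}) :
  (forall r i, r <= N -> i < l -> part_at Q r i = part_at Q' r i) -> Q = Q'.
Proof.
move=> QQ'; apply/ffunP => r; apply: boxed_eq => i lt_il.
by rewrite !part_at_ord QQ' // -ltnS.
Qed.

Section RppPaths.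

Variables (n : nat) (lam : seq nat) (lam_part : is_partition lam).

Let l := size lam.
Let m := part lam 0.
Implicit Types (Q : {ffun 'I_n.+1 -> boxed_shape l m}) (T : filling n lam).

Definition layer_chain Q : bool :=
  [&& Q ord0 == empty_shape l m, Q ord_max == lam_shape lam
    & [forall r : 'I_n, layer l.-1 (Q (widen_ord (leqnSn n) r)) (Q (lift ord0 r))]].

(** At index [l.-1] every row is compared with the row above it in the same later shape, so a chain
    of layers is just an increasing sequence of partitions. *)
Lemma layer_chainP Q :
  reflect [/\ forall i, part_at Q 0 i = 0, forall i, part_at Q n i = part lam i,
     forall r i, r < n -> part_at Q r i <= part_at Q r.+1 i
   & forall r i, r <= n -> part_at Q r i.+1 <= part_at Q r i]
   (layer_chain Q).
Proof.
apply: (iffP and3P) => [[/eqP Q0 /eqP Qn /forallP Qr] | [Q0 Qn Qr Qi]].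
  have Q0' i : part_at Q 0 i = 0 by rewrite -part_at_ord0 Q0 part_of_empty.
  split=> [//|i|r i lt_rn|[|r] i lt_rn]; last 1 first.
  - have [lt_il|le_li] := ltnP i.+1 l; last by rewrite part_at_out.
    have := Qr (Ordinal lt_rn) => /layerP /(_ _ lt_il) /andP[_] /=.
    by rewrite !part_at_lift !part_at_widen /=; if_lia.
  - by rewrite -part_at_max Qn part_of_lam.
  - have [lt_il|le_li] := ltnP i l; last by rewrite part_at_out.
    have := Qr (Ordinal lt_rn) => /layerP /(_ _ lt_il) /andP[].
    by rewrite part_at_widen part_at_lift.
  - by rewrite !Q0'.
split.
- by apply/eqP/boxed_eq => i _; rewrite part_at_ord0 Q0 part_of_empty.
- by apply/eqP/boxed_eq => i _; rewrite part_at_max Qn part_of_lam.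
apply/forallP => r; apply/layerP => i lt_il.
rewrite !part_at_widen !part_at_lift Qr //=; case: i lt_il => //= i lt_il.
by rewrite (_ : i < l.-1) ?Qi //; lia.
Qed.

Lemma layer_chain_sum (R : comNzRingType) (x t : nat -> R) :
  (path_sum (fun r => layer_kernel t l.-1 (x r)) (empty_shape l m) n (lam_shape lam) =
   \sum_(Q | layer_chain Q)
     \prod_(r < n) \prod_(i < l) layer_factor t (x r)
        (Q (widen_ord (leqnSn n) r)) (Q (lift ord0 r)) i)%R.
Proof.
rewrite path_sumE.
under eq_bigr => Q _ do rewrite prod_if.
by rewrite -big_mkcondr; apply: eq_bigl => Q; rewrite /layer_chain andbA.
Qed.

Lemma downset_count_ord (N : nat) (P : pred 'I_N) :
  (forall a b : 'I_N, a <= b -> P b -> P a) ->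
  forall r : 'I_N, (r < \sum_k P k) = P r.
Proof.
move=> downP r; pose P' k := if insub k is Some j then P j else false.
have P'E (k : 'I_N) : P' k = P k by rewrite /P' valK.
rewrite -P'E (eq_bigr (fun k : 'I_N => P' k : nat)) => [|k _]; last by rewrite P'E.
apply: downset_count => // a b le_ab lt_bN.
have lt_aN := leq_ltn_trans le_ab lt_bN.
rewrite -[a]/(nat_of_ord (Ordinal lt_aN)) -[b]/(nat_of_ord (Ordinal lt_bN)) !P'E.
exact: downP.
Qed.

(** The number of members of the chain that miss the box, which is the index of the first one
    containing it. *)
Definition rpp_of Q : filling n lam := [ffun p : grid lam =>
  if in_diagram p then inord (\sum_(r < n.+1) (part_at Q r p.1 <= p.2)) else ord0].

Definition chain_of T : {ffun 'I_n.+1 -> boxed_shape l m} :=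
  [ffun r : 'I_n.+1 => [ffun i : 'I_l =>
    inord (\sum_(j < m) (in_diagram ((i, j) : grid lam) && (T (i, j) <= r)))]].

Lemma chain_mono Q i a b : layer_chain Q -> a <= b -> b <= n ->
  part_at Q a i <= part_at Q b i.
Proof.
case/layer_chainP => _ _ Qr _; elim: b => [|b IHb]; first by rewrite leqn0 => /eqP->.
rewrite leq_eqVlt => /predU1P[-> // | le_ab] lt_bn.
exact: leq_trans (IHb le_ab (ltnW lt_bn)) (Qr _ _ lt_bn).
Qed.

Lemma chain_anti Q r i j : layer_chain Q -> r <= n -> i <= j ->
  part_at Q r j <= part_at Q r i.
Proof.
case/layer_chainP => _ _ _ Qi le_rn; elim: j => [|j IHj]; first by rewrite leqn0 => /eqP->.
rewrite leq_eqVlt => /predU1P[-> // | le_ij].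
exact: leq_trans (Qi _ _ le_rn) (IHj le_ij).
Qed.

Lemma rpp_ofE Q (p : grid lam) (r : nat) :
  layer_chain Q -> in_diagram p -> r <= n ->
  (rpp_of Q p <= r) = (p.2 < part_at Q r p.1).
Proof.
move=> chQ p_in le_rn; have [_ Qn _ _] := elimT (layer_chainP Q) chQ.
pose P k := part_at Q k p.1 <= p.2.
have countP : forall k, k < n.+1 -> (k < \sum_(r < n.+1) P r) = P k.
  by apply: downset_count => a b le_ab lt_bn; apply: leq_trans; apply: chain_mono.
rewrite ffunE p_in inordK; first by rewrite leqNgt countP // -ltnNge.
by rewrite ltnS leqNgt countP // /P Qn -ltnNge.
Qed.

(** Rows increase weakly, so the entries at most [r] fill an initial segment of row [i], whose
    length is the part. *)
Lemma chain_ofE T (r : nat) (i : 'I_l) (j : 'I_m) : is_rpp T -> r <= n ->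
  (j < part_at (chain_of T) r i) = in_diagram ((i, j) : grid lam) && (T (i, j) <= r).
Proof.
case/and3P => _ /forallP row_le _ le_rn.
rewrite /part_at part_of_ord !ffunE inordK; last first.
  rewrite ltnS -[X in _ <= X](card_ord m) -sum1_card.
  by apply: leq_sum => k _; apply: leq_b1.
rewrite inordK //.
pose P j := in_diagram ((i, j) : grid lam) && (T (i, j) <= r).
rewrite -[RHS]/(P j) -(downset_count_ord (P := P)) // => a b le_ab /andP[b_in Tb].
have a_in : in_diagram ((i, a) : grid lam) by apply: leq_ltn_trans le_ab b_in.
rewrite /P a_in; have /forallP /(_ (i, b)) := row_le (i, a).
by rewrite a_in b_in eqxx le_ab /= => /leq_trans; apply.
Qed.

Lemma chain_of_at T (r i : nat) : is_rpp T -> i < l -> r <= n -> forall a,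
  (forall (lt_il : i < l) (j : 'I_m), (in_diagram ((Ordinal lt_il, j) : grid lam) &&
      (T (Ordinal lt_il, j) <= r)) = (j < a)) ->
  a <= m -> part_at (chain_of T) r i = a.
Proof.
move=> rppT lt_il le_rn a Ta le_am; apply/eqP; rewrite eqn_leq; apply/andP; split.
  apply: (leq_below (part_at_le _ _ _)) => j lt_jm.
  have := chain_ofE (Ordinal lt_il) (Ordinal lt_jm) rppT le_rn.
  by rewrite Ta /= => ->.
apply: (leq_below le_am) => j lt_jm.
have := chain_ofE (Ordinal lt_il) (Ordinal lt_jm) rppT le_rn.
by rewrite Ta /= => ->.
Qed.

Lemma rpp_of_rpp Q : layer_chain Q -> is_rpp (rpp_of Q).
Proof.
move=> chQ; have [Q0 _ _ _] := elimT (layer_chainP Q) chQ.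
have T_le p : rpp_of Q p <= n by rewrite -ltnS.
apply/and3P; split; apply/forallP => p.
- have [p_in | p_out] := boolP (in_diagram p); last by rewrite ffunE (negPf p_out).
  by rewrite ltnNge (rpp_ofE _ p_in) // Q0.
- apply/forallP => q; apply/implyP => /and4P[p_in q_in /eqP pq le_pq].
  rewrite (rpp_ofE _ p_in) // pq; apply: leq_ltn_trans le_pq _.
  by rewrite -(rpp_ofE _ q_in).
- apply/forallP => q; apply/implyP => /and4P[p_in q_in /eqP pq le_pq].
  rewrite (rpp_ofE _ p_in) // pq; apply: leq_trans (chain_anti chQ (T_le q) le_pq).
  by rewrite -(rpp_ofE _ q_in).
Qed.

Lemma chain_of_chain T : is_rpp T -> layer_chain (chain_of T).
Proof.
move=> rppT; have /and3P[/forallP T0 _ /forallP col_le] := rppT.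
apply/layer_chainP; split=> [i|i|r i lt_rn|r i le_rn].
- have [lt_il|le_li] := ltnP i l; last by rewrite part_at_out.
  apply: chain_of_at => // {}lt_il j; by rewrite ltn0 -(eqP (T0 _)) lt0n leqn0 andNb.
- have [lt_il|le_li] := ltnP i l; last by rewrite part_at_out // /part nth_default.
  apply: chain_of_at => // [{}lt_il j|]; last exact: part_decr.
  by rewrite /in_diagram /= (_ : T _ <= n) ?andbT // -ltnS.
- have [lt_il|le_li] := ltnP i l; last by rewrite part_at_out.
  apply: (leq_below (part_at_le _ _ _)) => j lt_jm.
  pose i' := Ordinal lt_il; pose j' := Ordinal lt_jm.
  rewrite -[i]/(nat_of_ord i') -[j]/(nat_of_ord j').
  rewrite (chain_ofE _ _ rppT lt_rn) (chain_ofE _ _ rppT (ltnW lt_rn)).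
  by case/andP=> -> /leqW.
have [lt_il|le_li] := ltnP i.+1 l; last by rewrite part_at_out.
apply: (leq_below (part_at_le _ _ _)) => j lt_jm.
pose i' := Ordinal lt_il; pose i0 := Ordinal (ltnW lt_il); pose j' := Ordinal lt_jm.
rewrite -[i]/(nat_of_ord i0) -[(nat_of_ord i0).+1]/(nat_of_ord i') -[j]/(nat_of_ord j').
rewrite !chain_ofE // => /andP[in_j le_Tr].
have in_j0 : in_diagram ((i0, j') : grid lam).
  by apply: leq_trans in_j _; apply: part_decr => /=.
rewrite in_j0; have /forallP /(_ (i', j')) := col_le (i0, j').
by rewrite in_j in_j0 eqxx /= leqnSn /= => /leq_trans; apply.
Qed.

Lemma rpp_ofK Q : layer_chain Q -> chain_of (rpp_of Q) = Q.
Proof.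
move=> chQ; have [_ Qn _ _] := elimT (layer_chainP Q) chQ.
apply: chain_eq => r i le_rn lt_il; apply: chain_of_at => //.
- exact: rpp_of_rpp.
- move=> {}lt_il j; have [ij_in | ij_out] := boolP (in_diagram _).
    by rewrite (rpp_ofE chQ ij_in).
  apply/esym/negbTE; apply: contra ij_out => /leq_trans; apply.
  by rewrite /= -Qn chain_mono.
- exact: part_at_le.
Qed.

Lemma chain_ofK T : is_rpp T -> rpp_of (chain_of T) = T.
Proof.
move=> rppT; have chT := chain_of_chain rppT.
have /and3P[/forallP T0 _ _] := rppT.
apply/ffunP => p; apply: val_inj => /=.
have [p_in | p_out] := boolP (in_diagram p); last first.
  have := T0 p; rewrite ffunE (negPf p_out) eqbF_neg -leqNgt leqn0.
  by move=> /eqP->.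
have le_iff r : r <= n -> (rpp_of (chain_of T) p <= r) = (T p <= r).
  case: p p_in => i j p_in le_rn.
  by rewrite rpp_ofE //= chain_ofE // p_in.
have T_le (T' : filling n lam) : T' p <= n by rewrite -ltnS.
by apply/eqP; rewrite eqn_leq le_iff // leqnn -le_iff ?leqnn.
Qed.

(** * The two statistics of an RPP in terms of its chain *)

Lemma rpp_of_entry Q (p : grid lam) (r : nat) : layer_chain Q -> r < n ->
  in_diagram p && (rpp_of Q p == r.+1 :> nat) =
  (part_at Q r p.1 <= p.2 < part_at Q r.+1 p.1).
Proof.
move=> chQ lt_rn; have [p_in | p_out] /= := boolP (in_diagram p).
  rewrite [LHS](_ : _ = ~~ (rpp_of Q p <= r) && (rpp_of Q p <= r.+1));
    last by rewrite -ltnNge eqn_leq andbC.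
  by rewrite (rpp_ofE chQ p_in (ltnW lt_rn)) (rpp_ofE chQ p_in lt_rn) -leqNgt.
have [_ Qn _ _] := elimT (layer_chainP Q) chQ.
apply/esym/negbTE; rewrite negb_and -[X in _ || X]leqNgt; apply/orP; right.
by rewrite (leq_trans (chain_mono _ chQ lt_rn (leqnn n))) // Qn leqNgt.
Qed.

(** Each column containing [r.+1] is counted at its topmost box with that entry. Such a box in row
    [i] lies beyond the old row [i], within the new one, and below an old box if [i] is positive. *)
Lemma columns_containing_chain Q (r : 'I_n) : layer_chain Q ->
  columns_containing (rpp_of Q) r =
  \sum_(i < l) ((if i : nat is i'.+1 then minn (part_at Q r.+1 i) (part_at Q r i')
     else part_at Q r.+1 0) - part_at Q r i).
Proof.
move=> chQ; pose top i :=
  if i is i'.+1 then minn (part_at Q r.+1 i) (part_at Q r i') else part_at Q r.+1 0.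
have top_le i : top i <= part_at Q r.+1 i by case: i => //= i; apply: geq_minl.
transitivity (\sum_(j < m) \sum_(i < l) (part_at Q r i <= j < top i : nat)); last first.
  rewrite exchange_big; apply: eq_bigr => i _.
  by rewrite count_interval // (leq_trans (top_le i)) // part_at_le.
rewrite /columns_containing -sum1_card big_mkcond; apply: eq_bigr => j _.
rewrite inE; case: existsP => [[p /and3P[p_in /eqP pj Tp]] | no_p].
  have : in_diagram p && (rpp_of Q p == r.+1 :> nat) by rewrite p_in.
  rewrite rpp_of_entry // pj => /andP[le_pj lt_jp].
  (* The topmost new box of column [j] is in the first row that the old shape leaves free in this
     column. *)
  have ex_i : exists i, part_at Q r i <= j by exists p.1.
  case: (ex_minnP ex_i) => i0 le_i0j min_i0.
  have le_i0p : i0 <= p.1 by apply: min_i0.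
  have lt_i0l : i0 < l := leq_ltn_trans le_i0p (ltn_ord p.1).
  rewrite (bigD1 (Ordinal lt_i0l)) //= le_i0j /=.
  have -> : j < top i0.
    have lt_ji0 : j < part_at Q r.+1 i0.
      exact: leq_trans lt_jp (chain_anti chQ (ltn_ord r) le_i0p).
    case: i0 min_i0 {ex_i le_i0j le_i0p lt_i0l} lt_ji0 => //= i0 min_i0 lt_ji0.
    by rewrite leq_min lt_ji0 ltnNge; apply/negP => /min_i0; rewrite ltnn.
  rewrite big1 // => i neq_i; apply/eqP; rewrite eqb0.
  apply/negP => /andP[le_ij lt_ji]; have := min_i0 _ le_ij; rewrite leq_eqVlt.
  case/predU1P => [eq_i | lt_i0i]; first by case/eqP: neq_i; apply: val_inj.
  case: i lt_ji lt_i0i {neq_i le_ij} => -[|i] //= lt_il lt_ji lt_i0i.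
  have le_ij := leq_trans (chain_anti chQ (ltnW (ltn_ord r)) (lt_i0i : i0 <= i)) le_i0j.
  by move: lt_ji; rewrite leq_min [X in _ && X]ltnNge le_ij andbF.
rewrite big1 // => i _; apply/eqP; rewrite eqb0; apply/negP => /andP[le_ij lt_ji].
case: no_p; exists (i, j); rewrite eqxx /= rpp_of_entry //= le_ij /=.
exact: leq_trans lt_ji (top_le i).
Qed.

(** Two vertically adjacent boxes both have entry [r.+1] exactly when the upper one is not yet in
    shape [r] and the lower one is already in shape [r.+1]. *)
Lemma equal_below_chain Q (i : nat) : layer_chain Q -> i.+1 < l ->
  equal_below (rpp_of Q) i =
  \sum_(r < n) (part_at Q r.+1 i.+1 - part_at Q r i).
Proof.
move=> chQ lt_il.
pose i0 : 'I_l := Ordinal (ltnW lt_il); pose i1 : 'I_l := Ordinal lt_il.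
pose T := rpp_of Q.
have /and3P[/forallP T0 _ _] : is_rpp T := rpp_of_rpp chQ.
have in_below (j : 'I_m) : in_diagram ((i1, j) : grid lam) -> in_diagram ((i0, j) : grid lam).
  by move=> lt_j; apply: leq_trans lt_j _; apply: part_decr => /=.
transitivity (\sum_(j < m) (in_diagram ((i1, j) : grid lam) && (T (i1, j) == T (i0, j)))).
  pose B := [set j : 'I_m | in_diagram ((i1, j) : grid lam) && (T (i1, j) == T (i0, j))].
  transitivity #|B|; last first.
    rewrite -sum1_card big_mkcond; apply: eq_bigr => j _.
    by rewrite inE; case: (_ && _).
  rewrite -(card_imset _ (fun j j' (e : (i0, j) = (i0, j')) => congr1 snd e)).
  apply: eq_card => -[a b]; rewrite inE; apply/and3P/imsetP => /=.
    case=> _ /eqP aE /existsP[[a' b'] /and4P[/= ab_in /eqP a'E /eqP b'E eqT]].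
    have e0 : i0 = a by apply: val_inj; rewrite /= aE.
    have e1 : i1 = a' by apply: val_inj; rewrite /= a'E aE.
    by exists b; rewrite ?e0 // inE e0 e1 -b'E ab_in b'E /T -{1}b'E.
  case=> j; rewrite inE => /andP[j_in eqT] [-> ->]; rewrite eqxx in_below //; split=> //.
  by apply/existsP; exists (i1, j); rewrite j_in /= !eqxx.
transitivity (\sum_(j < m) \sum_(r < n) (part_at Q r i <= j < part_at Q r.+1 i.+1 : nat));
  last first.
  by rewrite exchange_big; apply: eq_bigr => r _; rewrite count_interval // part_at_le.
apply: eq_bigr => j _.
have entry (r : 'I_n) : (part_at Q r i <= j < part_at Q r.+1 i.+1) =
  [&& in_diagram ((i1, j) : grid lam), T (i1, j) == T (i0, j) & T (i0, j) == r.+1 :> nat].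
  have := rpp_of_entry (i0, j) chQ (ltn_ord r).
  have := rpp_of_entry (i1, j) chQ (ltn_ord r).
  rewrite -/T /= => e1 e0.
  have d0 := chain_anti chQ (ltn_ord r) (leqnSn i).
  have d1 := chain_anti chQ (ltnW (ltn_ord r)) (leqnSn i).
  apply/andP/and3P => [[le_j lt_j] | [j_in /eqP eqT Tr]].
    have := e0; rewrite le_j (leq_trans lt_j d0) => /andP[_ /eqP T0r].
    have := e1; rewrite (leq_trans d1 le_j) lt_j => /andP[j_in /eqP T1r].
    by split=> //; apply/eqP; rewrite ?T0r //; apply: val_inj; rewrite /= T0r.
  have := e0; rewrite (in_below _ j_in) Tr => /esym/andP[-> _].
  by have := e1; rewrite j_in eqT Tr => /esym/andP[_ ->].
under eq_bigr => r _ do rewrite entry.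
case: (boolP (in_diagram _)) => j_in /=; last by rewrite big1.
case: eqP => eqT /=; last by rewrite big1.
have T_gt0 : 0 < T (i0, j) by rewrite (eqP (T0 _)) in_below.
have lt_Tn : (T (i0, j)).-1 < n by have := ltn_ord (T (i0, j)); lia.
(* Step [r] of the chain adds the boxes with entry [r.+1], so the only contribution comes from the
   entry minus one. *)
rewrite (bigD1 (Ordinal lt_Tn)) //= prednK // eqxx big1 // => r neq_r.
apply/eqP; rewrite eqb0; apply: contra neq_r => /eqP Tr.
by apply/eqP/val_inj; rewrite /= Tr.
Qed.

Lemma prod_shift (R : comNzRingType) (F G : nat -> R) (N : nat) :
  (\prod_(i < N) (if i : nat is i'.+1 then F i * G i' else F 0%N) =
   (\prod_(i < N) F i) * \prod_(i < N.-1) G i)%R.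
Proof.
case: N => [|N]; first by rewrite !big_ord0 mulr1.
by rewrite !big_ord_recl -mulrA -big_split.
Qed.

Lemma dual_grothendieck_path_sum (R : comNzRingType) (x : 'I_n -> R)
    (t : 'I_l.-1 -> R) (x' t' : nat -> R) :
  (forall i : 'I_n, x i = x' i) -> (forall j : 'I_l.-1, t j = t' j) ->
  dual_grothendieck x t =
  path_sum (fun r => layer_kernel t' l.-1 (x' r)) (empty_shape l m) n (lam_shape lam).
Proof.
move=> xE tE; rewrite layer_chain_sum /dual_grothendieck.
rewrite (reindex_onto rpp_of chain_of) => [|T /chain_ofK //].
apply: eq_big => [Q | Q].
  apply/andP/idP => [[rppQ /eqP <-] | chQ]; first exact: chain_of_chain.
  by rewrite rpp_of_rpp // rpp_ofK.
case/andP=> rppQ /eqP QK; have chQ : layer_chain Q by rewrite -QK chain_of_chain.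
rewrite mulrC.
transitivity (\prod_(r < n) ((\prod_(i < l) x' r ^+
     ((if i : nat is i'.+1 then minn (part_at Q r.+1 i) (part_at Q r i')
     else part_at Q r.+1 0) - part_at Q r i)) *
   \prod_(i < l.-1) t' i ^+ (part_at Q r.+1 i.+1 - part_at Q r i)))%R.
  rewrite big_split /=; congr (_ * _)%R.
    apply: eq_bigr => r _; rewrite columns_containing_chain // xE.
    by rewrite expr_sum.
  rewrite exchange_big; apply: eq_bigr => i _ /=.
  by rewrite equal_below_chain ?expr_sum ?tE //; have := ltn_ord i; lia.
apply: eq_bigr => r _; 
rewrite -(prod_shift (fun i => x' r ^+ ((if i is i'.+1
    then minn (part_at Q r.+1 i) (part_at Q r i')
    else part_at Q r.+1 0) - part_at Q r i))%R
  (fun i => t' i ^+ (part_at Q r.+1 i.+1 - part_at Q r i))%R).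
by apply: eq_bigr => -[[|i] lt_il] _ /=; rewrite ?part_at_widen ?part_at_lift.
Qed.

End RppPaths.

(** * States of the vertex model as chains of strips *)

Section Particles.

Variables (l m : nat).
Implicit Types (p q : boxed_shape l m) (i c : nat).

Definition is_shape p : bool := [forall i : 'I_l, part_of p i.+1 <= part_of p i].

Lemma is_shapeP p : reflect (forall i, part_of p i.+1 <= part_of p i) (is_shape p).
Proof.
apply: (iffP (forall_ordP l (fun i => part_of p i.+1 <= part_of p i))) => [dec i | dec i _ //].
have [lt_il | le_li] := ltnP i l; first exact: dec.
by rewrite !part_of_out // ltnW.
Qed.

Lemma is_shape_anti p i j : is_shape p -> i <= j -> part_of p j <= part_of p i.
Proof.
move=> /is_shapeP dec; elim: j => [|j IHj]; first by rewrite leqn0 => /eqP->.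
by rewrite leq_eqVlt => /predU1P[-> // | /IHj]; apply: leq_trans.
Qed.

(** Adding the staircase turns a partition into a strictly decreasing sequence of particle columns,
    its Maya diagram. *)
Definition position p i : nat := part_of p i + (l - i.+1).

Definition occupied p c : bool := [exists i : 'I_l, c == position p i].

Definition rank p c : nat := \sum_(i < l) (position p i < c).

Lemma position_lt p i : i < l -> position p i < m + l.
Proof. by move=> lt_il; rewrite /position; have := part_of_le p i; lia. Qed.

Lemma position_decr p i j : is_shape p -> i < j -> j < l -> position p j < position p i.
Proof.
by move=> sp lt_ij lt_jl; have := is_shape_anti sp (ltnW lt_ij); rewrite /position; lia.
Qed.

Lemma position_inj p i j : is_shape p -> i < l -> j < l ->
  position p i = position p j -> i = j.
Proof.
move=> sp lt_il lt_jl eq_ij; case: (ltngtP i j) => // lt_ij.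
  by have := position_decr sp lt_ij lt_jl; rewrite eq_ij ltnn.
by have := position_decr sp lt_ij lt_il; rewrite eq_ij ltnn.
Qed.

(** Exactly [l - i.+1] particles lie to the left of particle [i]. Comparisons of single parts thus
    become comparisons of ranks, which sum up the local rules. *)
Lemma rank_lt p i c : is_shape p -> i < l -> (l - i.+1 < rank p c) = (position p i < c).
Proof.
move=> sp lt_il; rewrite /rank (reindex_inj rev_ord_inj) /=.
rewrite (downset_count (P := fun j => position p (l - j.+1) < c)).
- by rewrite (_ : l - (l - i.+1).+1 = i) //; lia.
- move=> a b le_ab lt_bl; apply: leq_trans; rewrite ltnS.
  have [<- // | neq_ab] := eqVneq a b.
  by apply/ltnW/position_decr => //; lia.
- by lia.
Qed.

Lemma rank_le p c : rank p c <= l.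
Proof. exact: (downset_count_le (fun i => position p i < c)). Qed.

Lemma rank0 p : rank p 0 = 0.
Proof. exact: big1. Qed.

Lemma rankS p c : is_shape p -> rank p c.+1 = rank p c + occupied p c.
Proof.
move=> sp; transitivity (rank p c + \sum_(i < l) (c == position p i)).
  by rewrite -big_split; apply: eq_bigr => i _ /=; lia.
congr (_ + _); rewrite /occupied; case: existsP => [[i0 /eqP c_i0] | no_i].
  rewrite (bigD1 i0) //= -c_i0 eqxx big1 // => i neq_i.
  apply/eqP; rewrite eqb0; apply: contra neq_i => /eqP c_i.
  by apply/eqP/val_inj/(position_inj sp); rewrite ?ltn_ord -?c_i.
by rewrite big1 // => i _; apply/eqP; rewrite eqb0; apply/negP => c_i; case: no_i; exists i.
Qed.

Lemma rank_max p c : is_shape p -> m + l <= c -> rank p c = l.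
Proof.
move=> sp le_c; apply/eqP; rewrite eqn_leq rank_le.
apply: (@leq_below l) => // j lt_jl _.
have := @rank_lt p (l - j.+1) c sp; rewrite (_ : l - (l - j.+1).+1 = j); last by lia.
move=> ->; last by lia.
by apply: leq_trans le_c; apply: position_lt; lia.
Qed.

Lemma rank_leP p q c c' : is_shape p -> is_shape q ->
  (forall i, i < l -> position p i < c -> position q i < c') ->
  rank p c <= rank q c'.
Proof.
move=> sp sq pq; apply: (leq_below (rank_le p c)) => j lt_jl.
have E : j = l - (l - j.+1).+1 by lia.
by rewrite E !rank_lt //; [apply: pq; lia | lia | lia].
Qed.

Lemma eq_shape p q : is_shape p -> is_shape q ->
  (forall c, c < m + l -> occupied p c = occupied q c) -> p = q.
Proof.
move=> sp sq pq.
have eq_rank c : rank p c = rank q c.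
  elim: c => [|c IHc]; first by rewrite !rank0.
  have [lt_c | le_c] := ltnP c (m + l); first by rewrite !rankS // IHc pq.
  by rewrite !rank_max // ltnW.
apply: boxed_eq => i lt_il.
have eq_lt c : (position p i < c) = (position q i < c) by rewrite -!rank_lt ?eq_rank.
have := eq_lt (position p i); have := eq_lt (position q i).
by rewrite !ltnn /position; lia.
Qed.

Lemma occupied_rank_eq p q c : is_shape p -> is_shape q ->
  rank p c = rank q c -> rank p c.+1 = rank q c.+1 -> occupied p c = occupied q c.
Proof. by move=> sp sq; rewrite !rankS // => ->; case: occupied; case: occupied; lia. Qed.

(** List the occupied columns in increasing order and subtract the staircase. *)
Lemma shape_of_config (V : pred nat) :
  \sum_(c < m + l) V c = l ->
  exists2 p, is_shape p & forall c, c < m + l -> occupied p c = V c.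
Proof.
move=> sumV; pose s := [seq c <- iota 0 (m + l) | V c].
have size_s : size s = l.
  rewrite size_filter -sum1_count -[RHS]sumV big_mkcond.
  by rewrite -(big_mkord xpredT (fun c => V c : nat)) /index_iota subn0.
have s_sorted : sorted ltn s.
  exact: (sorted_filter ltn_trans _ (iota_ltn_sorted 0 (m + l))).
have mem_s c : (c \in s) = V c && (c < m + l) by rewrite mem_filter mem_iota.
have s_lt k : k < l -> nth 0 s k < m + l.
  by move=> lt_kl; have := mem_nth 0 (_ : k < size s); rewrite size_s mem_s => /(_ lt_kl)/andP[].
have s_step k k' : k <= k' -> k' < l -> nth 0 s k + (k' - k) <= nth 0 s k'.
  elim: k' => [|k' IHk]; first by rewrite leqn0 => /eqP-> _; rewrite subnn addn0.
  rewrite leq_eqVlt => /predU1P[-> _ | le_kk' lt_k'l]; first by rewrite subnn addn0.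
  have := IHk le_kk' (ltnW lt_k'l).
  have : nth 0 s k' < nth 0 s k'.+1.
    by apply: (sorted_ltn_nth ltn_trans) => //; rewrite inE size_s // ltnW.
  by lia.
pose f i := nth 0 s (l - i.+1) - (l - i.+1).
have f_le i : i < l -> f i <= m.
  move=> lt_il; rewrite /f; have := s_lt l.-1; have := @s_step (l - i.+1) l.-1; lia.
pose p : boxed_shape l m := [ffun i : 'I_l => inord (f i)].
have pE i : i < l -> part_of p i = f i.
  move=> lt_il; rewrite -[i]/(nat_of_ord (Ordinal lt_il)) part_of_ord ffunE inordK //.
  by rewrite ltnS f_le.
have pos_p i : i < l -> position p i = nth 0 s (l - i.+1).
  move=> lt_il; rewrite /position pE // /f subnK //.
  by have := @s_step 0 (l - i.+1); lia.
exists p.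
  apply/is_shapeP => i; have [lt_il | le_li] := ltnP i.+1 l; last by rewrite part_of_out.
  rewrite (pE _ lt_il) (pE _ (ltnW lt_il)) /f; have := @s_step (l - i.+2) (l - i.+1); lia.
move=> c lt_c; apply/existsP/idP => [[i /eqP->] | Vc].
  rewrite pos_p //; have := mem_nth 0 (_ : l - i.+1 < size s).
  by rewrite size_s mem_s => /(_ _)/andP[] //; have := ltn_ord i; lia.
have c_in : c \in s by rewrite mem_s Vc.
have lt_k : index c s < l by rewrite -size_s index_mem.
have lt_i : l - (index c s).+1 < l by lia.
exists (Ordinal lt_i); rewrite pos_p //= (_ : l - _ = index c s) ?nth_index //; lia.
Qed.

Lemma config_rank p (V : pred nat) c : is_shape p ->
  (forall c', c' < m + l -> occupied p c' = V c') -> c <= m + l ->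
  \sum_(c' < c) V c' = rank p c.
Proof.
move=> sp pV; elim: c => [|c IHc] lt_c; first by rewrite big_ord0 rank0.
by rewrite big_ord_recr /= IHc ?rankS ?pV // ltnW.
Qed.

(* The local rule of a full row with particles p below and q above, H c being
   the label of the horizontal edge to the left of column c. *)
Definition transition p q (H : pred nat) : Prop :=
  [/\ ~~ H 0, ~~ H (m + l), forall c, c < m + l ->
      occupied q c + H c.+1 = occupied p c + H c
    & forall c, c < m + l -> ~~ (H c && occupied p c)].

(** Sum of the conservation laws over the columns left of [c]; it also shows that [H] is determined
    by [p] and [q]. *)
Lemma transition_rank p q H c : is_shape p -> is_shape q ->
  transition p q H -> c <= m + l -> H c + rank q c = rank p c.
Proof.
move=> sp sq [H0 _ cons _]; elim: c => [_|c IHc lt_c].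
  by rewrite !rank0 (negPf H0).
by rewrite !rankS // -(IHc (ltnW lt_c)); have := cons c lt_c; lia.
Qed.

Lemma transition_strip p q H : is_shape p -> is_shape q ->
  transition p q H -> horizontal_strip 0 p q.
Proof.
move=> sp sq tr; have rkE := transition_rank sp sq tr; have [_ _ _ block] := tr.
apply/horizontal_stripP => i lt_il /=; apply/andP; split.
  (* Particles only move right, because [H] is nonnegative. *)
  have := rkE (position q i).+1 (position_lt q lt_il).
  have := rank_lt (position q i).+1 sq lt_il; have := rank_lt (position q i).+1 sp lt_il.
  by rewrite !ltnS /position; lia.
(* No line enters the column where particle [i] stood, so the ranks agree there and particle [i.+1]
   stays strictly to its left. *)
apply/implyP; case: i lt_il => // i lt_il _ /=.
have lt_il' := ltnW lt_il; have lt_c := position_lt p lt_il'.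
have := rkE (position p i) (ltnW lt_c); have := block _ lt_c.
rewrite (_ : occupied p _) ?andbT; last first.
  by apply/existsP; exists (Ordinal lt_il').
have := rank_lt (position p i) sq lt_il; have := rank_lt (position p i) sp lt_il.
have := position_decr sp (ltnSn i) lt_il.
case: (H _) => //; rewrite /position; lia.
Qed.

Lemma transition_mover p q H (w : nat) i : is_shape p -> is_shape q ->
  transition p q H -> (forall c, w <= c -> c < m + l -> ~~ H c) ->
  i < l -> part_of p i < part_of q i -> position q i < w.
Proof.
move=> sp sq tr Hw lt_il lt_pq; rewrite ltnNge; apply/negP => le_w.
have lt_q := position_lt q lt_il.
have := transition_rank sp sq tr (ltnW lt_q); rewrite (negPf (Hw _ le_w lt_q)) add0n.
have := rank_lt (position q i) sq lt_il; have := rank_lt (position q i) sp lt_il.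
by move=> + + eq_rk; rewrite eq_rk ltnn => ->; rewrite /position; lia.
Qed.

(* By conservation this is the only possible label of the edge left of column c. *)
Definition crosses p q c : bool := rank q c < rank p c.

Lemma strip_rank_le p q k c : horizontal_strip k p q -> is_shape p -> is_shape q ->
  rank q c <= rank p c.
Proof.
move=> /horizontal_stripP st sp sq; apply: rank_leP => // i lt_il.
by have := st i lt_il; rewrite /position; if_lia.
Qed.

Lemma strip_part_le p q k i : horizontal_strip k p q -> part_of p i <= part_of q i.
Proof.
move=> /horizontal_stripP st; have [lt_il|le_li] := ltnP i l.
  by have := st i lt_il; if_lia.
by rewrite !part_of_out.
Qed.

Lemma strip_weaken p q k : is_shape q -> horizontal_strip k p q -> horizontal_strip 0 p q.
Proof.
move=> sq st; have le_pq i := strip_part_le i st.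
apply/horizontal_stripP => i lt_il /=; rewrite le_pq /=.
apply/implyP; case: i lt_il => // i lt_il _ /=.
have := elimT (horizontal_stripP _ _ _) st _ (ltnW lt_il).
have := elimT (horizontal_stripP _ _ _) st _ lt_il.
have := elimT (is_shapeP q) sq i; rewrite /=; if_lia.
Qed.

(** Interlacing keeps particle [i.+1] of [q] left of particle [i] of [p], so at most one particle
    crosses a given edge. *)
Lemma strip_rank_leS p q c : horizontal_strip 0 p q -> is_shape p -> is_shape q ->
  rank p c <= (rank q c).+1.
Proof.
move=> /horizontal_stripP st sp sq; apply: (leq_below (rank_le p c)) => j lt_jl.
case: j lt_jl => // j lt_jl.
rewrite (_ : j.+1 = l - (l - j.+2).+1) ?rank_lt //; try lia.
move=> lt_c; rewrite ltnS (_ : l - _ = (l - (l - j.+1).+1).+1); last by lia.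
rewrite rank_lt //; last by lia.
apply: leq_trans lt_c; rewrite ltnS.
have lt_i : l - j.+1 < l by lia.
have := st _ lt_i; rewrite (_ : l - j.+1 = (l - j.+2).+1); last by lia.
rewrite /position /=; lia.
Qed.

Lemma crosses_nat p q c : horizontal_strip 0 p q -> is_shape p -> is_shape q ->
  crosses p q c + rank q c = rank p c.
Proof.
move=> st sp sq; have := strip_rank_le c st sp sq; have := strip_rank_leS c st sp sq.
by rewrite /crosses; lia.
Qed.

Lemma strip_transition p q : horizontal_strip 0 p q -> is_shape p -> is_shape q ->
  transition p q (crosses p q).
Proof.
move=> st sp sq; have crE c := crosses_nat c st sp sq.
split; [by rewrite /crosses !rank0 | by rewrite /crosses !rank_max // ltnn | |].
  move=> c lt_c; have := crE c.+1; have := crE c; rewrite !rankS //; lia.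
move=> c lt_c; apply/negP => /andP[cr /existsP[i /eqP c_i]].
have lt_il := ltn_ord i.
have := crE c; rewrite cr; have := rank_lt c sp lt_il; have := rank_le p c.
(* At the column of particle [i] of [p], the rank of [p] is at most [l - i.+1], and by interlacing
   that of [q] is no smaller; hence no crossing. For the last particle the rank of [p] is zero. *)
case: (ltnP i.+1 l) => [lt_iSl | le_lSi].
  have := rank_lt c sq lt_iSl; have := position_decr sp (ltnSn i) lt_iSl.
  have := elimT (horizontal_stripP _ _ _) st _ lt_iSl; rewrite c_i /position /=; lia.
by rewrite c_i ltnn; lia.
Qed.

Lemma crosses_beyond p q (w c : nat) : horizontal_strip 0 p q -> is_shape p -> is_shape q ->
  (forall i, i < l -> part_of p i < part_of q i -> position q i < w) ->
  w <= c -> crosses p q c = false.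
Proof.
move=> st sp sq mv le_wc; apply/negbTE; rewrite -leqNgt; apply: rank_leP => // i lt_il.
have [lt_pq _ | le_qp] := ltnP (part_of p i) (part_of q i).
  exact: leq_trans (mv i lt_il lt_pq) le_wc.
by apply: leq_ltn_trans; rewrite /position leq_add2r.
Qed.

(** Particle [i] passes the edges [c] with [position p i < c <= position q i], so the horizontal
    labels add up to the size of the strip. *)
Lemma sum_crosses p q : horizontal_strip 0 p q -> is_shape p -> is_shape q ->
  \sum_(c < m + l) crosses p q c = \sum_(i < l) (part_of q i - part_of p i).
Proof.
move=> st sp sq; have le_pq i := strip_part_le i st.
transitivity (\sum_(c < m + l) \sum_(i < l)
    ((position p i).+1 <= c < (position q i).+1 : nat)).
  apply: eq_bigr => c _; apply/eqP; rewrite -(eqn_add2r (rank q c)) crosses_nat //.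
  rewrite -big_split /=; apply/eqP/eq_bigr => i _.
  by have := le_pq i; rewrite /position; lia.
rewrite exchange_big; apply: eq_bigr => i _ /=.
rewrite count_interval ?position_lt //.
by have := le_pq i; rewrite /position; lia.
Qed.

End Particles.

(** Conservation plus exclusion, and a factor [z] for each line entering from the left. *)
Lemma vertex_weightE (R : comNzRingType) (z : R) (top right bottom left : bool) :
  vertex_weight z top right bottom left =
  (if (top + right == bottom + left)%N && ~~ (left && bottom) then z ^+ left else 0)%R.
Proof. by case: top; case: right; case: bottom; case: left. Qed.

Lemma widen_inord (N : nat) (r : 'I_N) : widen_ord (leqnSn N) r = inord r.
Proof. by apply: val_inj; rewrite /= inordK // ltnS ltnW. Qed.

Lemma lift_inord (N : nat) (r : 'I_N) : lift ord0 r = inord r.+1.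
Proof. by apply: val_inj; rewrite /= inordK // ltnS. Qed.

(** * Shortened rows and frozen parts *)

Section VertexPaths.

Variables (n : nat) (lam : seq nat) (lam_part : is_partition lam).

Let l := size lam.
Let m := part lam 0.
Let N := nrows n lam.
Implicit Types (Q : {ffun 'I_N.+1 -> boxed_shape l m}) (s : labeling n lam).

Let lamS : boxed_shape l m := lam_shape lam.

Lemma lam_is_shape : is_shape lamS.
Proof. by apply/is_shapeP => i; rewrite !part_of_lam // part_decr. Qed.

Lemma empty_is_shape : is_shape (empty_shape l m).
Proof. by apply/is_shapeP => i; rewrite !part_of_empty. Qed.

Lemma occupied_lam c : occupied lamS c = [exists i : 'I_l, c.+1 == part lam i + l - i].
Proof.
apply: eq_existsb => i; rewrite /position part_of_lam //.
by have := ltn_ord i; case: eqP; case: eqP => //; lia.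
Qed.

Lemma occupied_empty c : occupied (empty_shape l m) c = (c < l).
Proof.
apply/existsP/idP => [[i /eqP->] | lt_cl].
  by rewrite /position part_of_empty; have := ltn_ord i; lia.
have lt_il : l - c.+1 < l by lia.
by exists (Ordinal lt_il); rewrite /position part_of_empty /=; lia.
Qed.

Lemma width_anti r r' : r <= r' -> width n lam r' <= width n lam r.
Proof.
move=> le_r; rewrite /width; case: ltnP => rn; case: ltnP => rn'; try lia.
  by have := part_decr lam_part (leq0n (r' - n).+1); lia.
have le_k : (r - n).+1 <= (r' - n).+1 by lia.
by have := part_decr lam_part le_k; lia.
Qed.

Lemma width_le r : width n lam r <= m + l.
Proof.
by rewrite /width; have := part_decr lam_part (leq0n (r - n).+1); case: ifP; rewrite /m /l; lia.
Qed.

Definition frozen (r : nat) : nat := if r < n then 0 else (r - n).+1.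

(** For [r >= n] the last column of row [r] is the final position of particle [frozen r]; the
    particles before it end strictly beyond the row. *)
Lemma frozen_width r i : r < N -> i < l ->
  (position lamS i < width n lam r) = (frozen r <= i) || (r < n).
Proof.
move=> lt_rN lt_il; rewrite /width /frozen; case: (ltnP r n) => rn.
  by rewrite orbT position_lt.
have lt_kl : (r - n).+1 < l by move: lt_rN; rewrite /N /nrows -/l; lia.
rewrite orbF /position part_of_lam //.
have [le_i | lt_i] := leqP (r - n).+1 i.
  by have := part_decr lam_part le_i; lia.
by have := part_decr lam_part (ltnW lt_i); lia.
Qed.

Definition strip_chain Q : bool :=
  [&& Q ord0 == empty_shape l m, Q ord_max == lamS
    & [forall r : 'I_N, horizontal_strip (frozen r)
        (Q (widen_ord (leqnSn N) r)) (Q (lift ord0 r))]].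

Lemma strip_chainP Q :
  reflect [/\ Q (inord 0) = empty_shape l m, Q (inord N) = lamS &
    forall r, r < N -> horizontal_strip (frozen r) (Q (inord r)) (Q (inord r.+1))]
  (strip_chain Q).
Proof.
have E0 : ord0 = inord 0 :> 'I_N.+1 by apply: val_inj; rewrite /= inordK.
have EN : ord_max = inord N :> 'I_N.+1 by apply: val_inj; rewrite /= inordK.
apply: (iffP and3P); rewrite E0 EN => -[].
  move=> /eqP Q0 /eqP QN /forallP Qr; split=> // r lt_rN.
  by have := Qr (Ordinal lt_rN); rewrite widen_inord -E0 lift_inord.
move=> -> -> Qr; rewrite !eqxx; split=> //; apply/forallP => r.
by rewrite widen_inord -E0 lift_inord Qr.
Qed.

Lemma strip_chain_sum (R : comNzRingType) (x t : nat -> R) :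
  (path_sum (vertex_kernel t n x) (empty_shape l m) N lamS =
   \sum_(Q | strip_chain Q)
     \prod_(r < N) (if (r < n)%N then x r else t (r - n)%N) ^+
       \sum_(i < l) (part_of (Q (inord r.+1)) i - part_of (Q (inord r)) i))%R.
Proof.
rewrite path_sumE.
transitivity (\sum_(Q : {ffun 'I_N.+1 -> boxed_shape l m} |
    (Q ord0 == empty_shape l m) && (Q ord_max == lamS))
  \prod_(r < N) if horizontal_strip (frozen r) (Q (widen_ord (leqnSn N) r)) (Q (lift ord0 r))
    then (if (r < n)%N then x r else t (r - n)%N) ^+
       \sum_(i < l) (part_of (Q (inord r.+1)) i - part_of (Q (inord r)) i) else 0)%R.
  apply: eq_bigr => Q _; apply: eq_bigr => r _.
  rewrite /vertex_kernel /frozen /strip_kernel widen_inord lift_inord.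
  by case: (r < n); rewrite expr_sum.
under eq_bigr => Q _ do rewrite prod_if.
by rewrite -big_mkcondr; apply: eq_bigl => Q; rewrite /strip_chain andbA.
Qed.

Lemma strip_chain_shape Q r : strip_chain Q -> r <= N -> is_shape (Q (inord r)).
Proof.
move=> /strip_chainP[Q0 _ Qr]; elim: r => [_|r IHr lt_rN].
  by rewrite Q0 empty_is_shape.
have /horizontal_stripP st := Qr r lt_rN; have /is_shapeP dec := IHr (ltnW lt_rN).
apply/is_shapeP => i; have [lt_il|le_li] := ltnP i.+1 l; last by rewrite part_of_out.
have := st _ lt_il; have := st _ (ltnW lt_il); have := dec i; rewrite /=; if_lia.
Qed.

Lemma strip_chain_le_lam Q r i : strip_chain Q -> r <= N ->
  part_of (Q (inord r)) i <= part lam i.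
Proof.
move=> /strip_chainP[_ QN Qr] le_rN; rewrite -(part_of_lam lam_part) -[lam_shape _]QN.
rewrite -(subKn le_rN); elim: (N - r) (leq_subr r N) => [|d IHd] lt_dN.
  by rewrite subn0.
apply: leq_trans (IHd (ltnW lt_dN)).
have lt_r : N - d.+1 < N by lia.
by have := strip_part_le i (Qr _ lt_r); rewrite (_ : (N - d.+1).+1 = N - d) //; lia.
Qed.

(** A moving particle is not frozen, and it never goes beyond its final position, which lies inside
    the row. *)
Lemma strip_chain_mover Q r i : strip_chain Q -> r < N -> i < l ->
  part_of (Q (inord r)) i < part_of (Q (inord r.+1)) i ->
  position (Q (inord r.+1)) i < width n lam r.
Proof.
move=> chQ lt_rN lt_il lt_r.
have [_ _ /(_ _ lt_rN) /horizontal_stripP /(_ _ lt_il)] := elimT (strip_chainP Q) chQ.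
case: ifP => [_ /eqP eq_r | ]; first by rewrite eq_r ltnn in lt_r.
rewrite ltnNge => /negbFE fr _.
apply: leq_ltn_trans (_ : _ <= position lamS i) _; last by rewrite frozen_width ?fr.
by rewrite leq_add2r part_of_lam // strip_chain_le_lam.
Qed.

Lemma strip_chain_step Q r : strip_chain Q -> r < N ->
  [/\ horizontal_strip 0 (Q (inord r)) (Q (inord r.+1)), is_shape (Q (inord r)) &
      is_shape (Q (inord r.+1))].
Proof.
move=> chQ lt_rN; have sq := strip_chain_shape chQ lt_rN.
split=> //; last exact: strip_chain_shape chQ (ltnW lt_rN).
by have [_ _ /(_ _ lt_rN) /strip_weaken] := elimT (strip_chainP Q) chQ; apply.
Qed.

Lemma chain_crosses_beyond Q r c : strip_chain Q -> r < N -> width n lam r <= c ->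
  crosses (Q (inord r)) (Q (inord r.+1)) c = false.
Proof.
move=> chQ lt_rN; have [st sp sq] := strip_chain_step chQ lt_rN.
by apply: crosses_beyond => // i; apply: strip_chain_mover.
Qed.

(** No line crosses either side of column [c] in the remaining rows, so its occupation is already
    the final one. This gives the top boundary labels. *)
Lemma chain_occupied_beyond Q r c : strip_chain Q -> r <= N ->
  (forall r', r <= r' -> r' < N -> width n lam r' <= c) ->
  occupied (Q (inord r)) c = occupied lamS c.
Proof.
move=> chQ le_rN; have [_ QN _] := elimT (strip_chainP Q) chQ.
rewrite -(subKn le_rN); elim: (N - r) (leq_subr r N) => [|d IHd] lt_dN wc.
  by rewrite subn0 QN.
have lt_r : N - d.+1 < N by lia.
have Er : N - d = (N - d.+1).+1 by lia.
have le_wc := wc _ (leqnn _) lt_r.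
have [st sp sq] := strip_chain_step chQ lt_r.
rewrite -IHd ?(ltnW lt_dN) // => [|r' le_r' lt_r']; last by apply: wc => //; lia.
rewrite Er; apply: occupied_rank_eq => //.
  by have := crosses_nat c st sp sq; rewrite chain_crosses_beyond.
by have := crosses_nat c.+1 st sp sq; rewrite chain_crosses_beyond // ltnW.
Qed.

Let C := ncols lam.

(* Beyond the end of the truncated rows the columns are continued upwards with
   their boundary label, so that every row carries exactly l particles. *)
Definition config s (r : 'I_N.+1) (c : nat) : bool :=
  if insub c is Some c' then
    if is_vedge n lam r c then s.1 (r, c') else occupied lamS c
  else false.

Definition hedge s (r : 'I_N) (c : nat) : bool := s.2 (r, inord c).

Definition chain_of_state s : {ffun 'I_N.+1 -> boxed_shape l m} :=
  [ffun r : 'I_N.+1 => odflt (empty_shape l m)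
     [pick p | is_shape p && [forall c : 'I_C, occupied p c == config s r c]]].

(** Only the vertical labels are cut off by [is_vedge]: for a strip chain the crossings already
    vanish beyond the row, by [chain_crosses_beyond]. *)
Definition state_of Q : labeling n lam :=
  ([ffun v : 'I_N.+1 * 'I_C => is_vedge n lam v.1 v.2 && occupied (Q v.1) v.2],
   [ffun v : 'I_N * 'I_C.+1 => crosses (Q (inord v.1)) (Q (inord v.1.+1)) v.2]).

Lemma config_ord s (r : 'I_N.+1) (c : 'I_C) :
  config s r c = if is_vedge n lam r c then s.1 (r, c) else occupied lamS c.
Proof. by rewrite /config valK. Qed.

Lemma is_vedge_vertex (r c : nat) : is_vertex n lam r c ->
  is_vedge n lam r c /\ is_vedge n lam r.+1 c.
Proof.
move=> rc; split=> //; case: r rc => [|r] /andP[lt_rN lt_c] /=.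
  exact: leq_trans lt_c (width_le 0).
by apply/andP; split; [apply: ltnW | apply: leq_trans lt_c (width_anti (leqnSn r))].
Qed.

(** * Bijection between states and strip chains *)

Section Weights.

Variables (R : comNzRingType) (x : 'I_n -> R) (t : 'I_l.-1 -> R) (x' t' : nat -> R).
Hypotheses (xE : forall i : 'I_n, x i = x' i) (tE : forall j : 'I_l.-1, t j = t' j).
Hypotheses (x_neq0 : forall i, x i != 0%R) (t_neq0 : forall j, t j != 0%R).

Lemma spectralE (r : 'I_N) :
  spectral x t r = if r < n then x' r else t' (r - n).
Proof.
by rewrite /spectral; case: splitP => j ->; rewrite ?addKn ?xE ?tE.
Qed.

Lemma spectral_neq0 (r : 'I_N) : spectral x t r != 0%R.
Proof. by rewrite /spectral; case: split => j. Qed.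

Lemma state_hedge_beyond s (r : 'I_N) (c : nat) : is_state x t s ->
  c <= C -> width n lam r <= c -> hedge s r c = false.
Proof.
case/and3P => /andP[_ /forallP lab2] /and4P[/forallP left0 /forallP right0 _ _] _ le_cC le_wc.
have c_ord : (inord c : 'I_C.+1) = c :> nat by rewrite inordK.
apply/negbTE/negP => Hrc; have := forallP (lab2 r) (inord c); rewrite [s.2 _]Hrc /=.
case: (posnP c) => [c0 | c_gt0] hrc.
  move: Hrc; rewrite /hedge (_ : inord c = ord0) ?(eqP (left0 r)) //.
  by apply: val_inj; rewrite /= c_ord.
have := forallP (right0 r) (inord c); rewrite hrc [s.2 _]Hrc c_ord /is_vertex.
by rewrite [c < _]ltnNge le_wc andbF.
Qed.

(** Inside the row this is the nonvanishing of the vertex weight; beyond it the horizontal labels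
    are 0 and [config] continues the column with its top label. *)
Lemma state_vertex s (r : 'I_N) (c : nat) : is_state x t s -> c < C ->
  config s (inord r.+1) c + hedge s r c.+1 = config s (inord r) c + hedge s r c /\
  ~~ (hedge s r c && config s (inord r) c).
Proof.
move=> st lt_cC; have [lab bd wt] := and3P st.
have [_ _ _ /forallP top] := and4P bd.
pose c0 : 'I_C := Ordinal lt_cC.
have r_ord : (inord r : 'I_N.+1) = r :> nat by rewrite inordK // ltnS ltnW.
have r1_ord : (inord r.+1 : 'I_N.+1) = r.+1 :> nat by rewrite inordK // ltnS.
rewrite -[c]/(nat_of_ord c0) !config_ord r_ord r1_ord.
have [lt_cw | le_wc] := ltnP c (width n lam r).
  have rc_in : is_vertex n lam r c0 by apply/andP; split; first exact: ltn_ord.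
  have [-> ->] := is_vedge_vertex rc_in.
  have := forallP wt (r, c0); rewrite rc_in /= vertex_weightE.
  rewrite !widen_inord !lift_inord.
  by case: ifP => [/andP[/eqP-> ->] // | _]; rewrite eqxx.
have Hc : hedge s r c0 = false := state_hedge_beyond st (ltnW lt_cC) le_wc.
have Hc1 : hedge s r c0.+1 = false := state_hedge_beyond st lt_cC (leqW le_wc).
rewrite Hc Hc1.
rewrite /= /is_vertex [c < _]ltnNge le_wc andbF !addn0; split=> //.
case: ifP => // rc_v; apply/esym.
have /implyP := forallP (top (inord r)) c0.
rewrite r_ord rc_v /is_vertex [(c0 : nat) < _]ltnNge le_wc andbF => /(_ isT) /eqP ->.
by rewrite occupied_lam.
Qed.

Lemma state_config0 s c : is_state x t s -> c < C ->
  config s (inord 0) c = occupied (empty_shape l m) c.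
Proof.
case/and3P => _ /and4P[_ _ /forallP bot _] _ lt_cC.
have -> : inord 0 = ord0 :> 'I_N.+1 by apply: val_inj; rewrite /= inordK.
rewrite -[c]/(nat_of_ord (Ordinal lt_cC)) config_ord /= lt_cC (eqP (bot _)).
by rewrite occupied_empty.
Qed.

Lemma state_configN s c : is_state x t s -> c < C ->
  config s (inord N) c = occupied lamS c.
Proof.
case/and3P => _ /and4P[_ _ _ /forallP top] _ lt_cC.
rewrite -[c]/(nat_of_ord (Ordinal lt_cC)) config_ord; case: ifP => // rc_v.
have /implyP := forallP (top (inord N)) (Ordinal lt_cC).
by rewrite rc_v inordK // /is_vertex ltnn => /(_ isT) /eqP ->; rewrite occupied_lam.
Qed.

(** The left and right boundary labels are 0, so the number of particles is preserved from one row
    to the next. *)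
Lemma state_config_sum s r : is_state x t s -> r <= N ->
  \sum_(c < m + l) config s (inord r) c = l.
Proof.
move=> st; elim: r => [_|r IHr lt_rN].
  rewrite -[RHS](rank_max empty_is_shape (leqnn _)).
  by apply: config_rank => // [|c lt_c]; [apply: empty_is_shape | rewrite state_config0].
pose r0 : 'I_N := Ordinal lt_rN.
have cons c (le_c : c <= m + l) : \sum_(c' < c) config s (inord r.+1) c' + hedge s r0 c
    = \sum_(c' < c) config s (inord r) c' + hedge s r0 0.
  elim: c le_c => [|c IHc] lt_c; first by rewrite !big_ord0.
  rewrite !big_ord_recr /=.
  have [] := state_vertex r0 st lt_c; have := IHc (ltnW lt_c); rewrite /=; lia.
have := cons _ (leqnn _); rewrite (state_hedge_beyond st) ?width_le // addn0.
rewrite (_ : hedge s r0 0 = false) ?addn0 => [->|]; first exact: IHr (ltnW lt_rN).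
have /and3P[_ /and4P[/forallP left0 _ _ _] _] := st.
rewrite /hedge (_ : inord 0 = ord0) ?(eqP (left0 _)) //.
by apply: val_inj; rewrite /= inordK.
Qed.

Lemma chain_of_state_spec s r : is_state x t s -> r <= N ->
  is_shape (chain_of_state s (inord r)) /\
  forall c, c < m + l -> occupied (chain_of_state s (inord r)) c = config s (inord r) c.
Proof.
move=> st le_rN; rewrite ffunE; case: pickP => [p /andP[sp /forallP pc] | no_p] /=.
  by split=> // c lt_c; have /eqP := pc (Ordinal lt_c).
have [p sp pc] := shape_of_config (state_config_sum st le_rN).
have := no_p p; rewrite sp /= => /negP[]; apply/forallP => c.
by apply/eqP/pc.
Qed.

Lemma chain_of_state_transition s (r : 'I_N) : is_state x t s ->
  transition (chain_of_state s (inord r)) (chain_of_state s (inord r.+1)) (hedge s r).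
Proof.
move=> st; have [_ pc] := chain_of_state_spec st (ltnW (ltn_ord r)).
have [_ qc] := chain_of_state_spec st (ltn_ord r).
split=> [||c lt_c|c lt_c].
- have /and3P[_ /and4P[/forallP left0 _ _ _] _] := st.
  rewrite /hedge (_ : inord 0 = ord0) ?(eqP (left0 _)) //.
  by apply: val_inj; rewrite /= inordK.
- by rewrite (state_hedge_beyond st) ?width_le.
- by rewrite pc // qc //; have [] := state_vertex r st lt_c.
- by rewrite pc //; have [] := state_vertex r st lt_c.
Qed.

Lemma chain_of_state_mover s (r : 'I_N) i : is_state x t s -> i < l ->
  part_of (chain_of_state s (inord r)) i < part_of (chain_of_state s (inord r.+1)) i ->
  position (chain_of_state s (inord r.+1)) i < width n lam r.
Proof.
move=> st lt_il; have [sp _] := chain_of_state_spec st (ltnW (ltn_ord r)).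
have [sq _] := chain_of_state_spec st (ltn_ord r).
apply: (transition_mover sp sq (chain_of_state_transition r st)) => // c le_wc lt_c.
by rewrite (state_hedge_beyond st) // ltnW.
Qed.

Lemma chain_of_state_end s : is_state x t s -> chain_of_state s (inord N) = lamS.
Proof.
move=> st; have [sp pc] := chain_of_state_spec st (leqnn N).
by apply: (eq_shape sp lam_is_shape) => c lt_c; rewrite pc // state_configN.
Qed.

(* Downwards from the top row: if such a part moved last in row r, it would end
   beyond the right end of that row. *)
Lemma chain_of_state_frozen s r i : is_state x t s -> r <= N -> i < l -> i < frozen r ->
  part_of (chain_of_state s (inord r)) i = part lam i.
Proof.
move=> st le_rN lt_il; rewrite -(subKn le_rN).
elim: (N - r) (leq_subr r N) => [|d IHd] lt_dN lt_i.
  by rewrite subn0 chain_of_state_end // part_of_lam.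
have lt_r : N - d.+1 < N by lia.
have Er : N - d = (N - d.+1).+1 by lia.
have [sp _] := chain_of_state_spec st (ltnW lt_r).
have [sq _] := chain_of_state_spec st lt_r.
have /horizontal_stripP/(_ i lt_il)/andP[le_pq _] :=
  transition_strip sp sq (chain_of_state_transition (Ordinal lt_r) st).
have q_i : part_of (chain_of_state s (inord (N - d.+1).+1)) i = part lam i.
  rewrite -Er; apply: IHd (ltnW lt_dN) _; apply: leq_trans lt_i _.
  by rewrite /frozen Er; if_lia.
rewrite q_i in le_pq; apply/eqP; rewrite eqn_leq le_pq leqNgt /=; apply/negP.
rewrite -{1}q_i => /(@chain_of_state_mover s (Ordinal lt_r) i st lt_il) /=.
have -> : position (chain_of_state s (inord (N - d.+1).+1)) i = position lamS i.
  by rewrite /position q_i part_of_lam.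
rewrite frozen_width // [frozen _ <= i]leqNgt lt_i /= => lt_n.
by move: lt_i; rewrite /frozen lt_n.
Qed.

Lemma chain_of_state_chain s : is_state x t s -> strip_chain (chain_of_state s).
Proof.
move=> st; apply/strip_chainP; split; [ | exact: chain_of_state_end | move=> r lt_rN].
  have [sp pc] := chain_of_state_spec st (leq0n N).
  by apply: (eq_shape sp empty_is_shape) => c lt_c; rewrite pc // state_config0.
have [sp _] := chain_of_state_spec st (ltnW lt_rN).
have [sq _] := chain_of_state_spec st lt_rN.
have /horizontal_stripP str :=
  transition_strip sp sq (chain_of_state_transition (Ordinal lt_rN) st).
apply/horizontal_stripP => i lt_il; case: ifP => lt_i; last exact: str.
have lt_i1 : i < frozen r.+1 by apply: leq_trans lt_i _; rewrite /frozen; if_lia.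
by rewrite (chain_of_state_frozen st (ltnW lt_rN) lt_il lt_i) chain_of_state_frozen.
Qed.

Lemma chain_of_stateK s : is_state x t s -> state_of (chain_of_state s) = s.
Proof.
move=> st; have /and3P[/andP[/forallP lab1 _] _ _] := st.
rewrite [RHS]surjective_pairing; congr pair; apply/ffunP => -[r c]; rewrite ffunE /=.
  have le_rN : r <= N by rewrite -ltnS.
  have [_ pc] := chain_of_state_spec st le_rN; rewrite inord_val in pc.
  rewrite pc ?ltn_ord // config_ord; case: ifP => //= rc.
  by apply/esym/negbTE; apply: contraFN rc; apply/implyP/(forallP (lab1 r)).
have [sp _] := chain_of_state_spec st (ltnW (ltn_ord r)).
have [sq _] := chain_of_state_spec st (ltn_ord r).
have le_c : c <= m + l by rewrite -ltnS.
rewrite /crosses -(transition_rank sp sq (chain_of_state_transition r st) le_c).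
by rewrite /hedge inord_val; case: (s.2 _); rewrite ?ltnSn // ltnn.
Qed.

Lemma state_of_vertical Q r c : strip_chain Q -> r <= N -> c < C ->
  config (state_of Q) (inord r) c = occupied (Q (inord r)) c.
Proof.
move=> chQ le_rN lt_cC.
rewrite -[c]/(nat_of_ord (Ordinal lt_cC)) config_ord ffunE /= inordK //.
case: ifP => [-> //|]; case: r le_rN => [|r] lt_rN /=; first by rewrite lt_cC.
rewrite /is_vertex lt_rN /= => /negbT; rewrite -leqNgt => le_wc.
apply/esym/chain_occupied_beyond => // r' lt_rr' _.
exact: leq_trans (width_anti (ltnW lt_rr')) le_wc.
Qed.

Lemma state_of_weight_at Q (v : 'I_N * 'I_C) : strip_chain Q -> is_vertex n lam v.1 v.2 ->
  weight_at x t (state_of Q) v =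
  (spectral x t v.1 ^+ crosses (Q (inord v.1)) (Q (inord v.1.+1)) v.2)%R.
Proof.
case: v => r c chQ /= rc_in; have [rc_v _] := is_vedge_vertex rc_in.
have [st sp sq] := strip_chain_step chQ (ltn_ord r).
have [_ _ cons block] := strip_transition st sp sq.
have /eqP := cons c (ltn_ord c); have := block c (ltn_ord c).
rewrite vertex_weightE !ffunE /= widen_inord lift_inord /bump add0n add1n rc_in rc_v /=.
by move=> -> ->.
Qed.

(** States require nonzero vertex weights, which here are powers of spectral parameters with
    exponent 0 or 1; hence the hypotheses [x_neq0] and [t_neq0]. *)
Lemma state_of_state Q : strip_chain Q -> is_state x t (state_of Q).
Proof.
move=> chQ; have [Q0 QN _] := elimT (strip_chainP Q) chQ.
have cross_width (r : 'I_N) c : crosses (Q (inord r)) (Q (inord r.+1)) c -> c < width n lam r.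
  by rewrite ltnNge; apply: contraL => le_wc; rewrite chain_crosses_beyond.
have cross0 (r : 'I_N) : crosses (Q (inord r)) (Q (inord r.+1)) 0 = false.
  by rewrite /crosses !rank0.
apply/and3P; split.
- apply/andP; split; apply/forallP => r; apply/forallP => c; apply/implyP; rewrite ffunE /=.
    by case/andP.
  case: (nat_of_ord c) => [_|c' cr]; first exact: ltn_ord.
  by apply/andP; split; [apply: ltn_ord | apply: ltnW (cross_width _ _ cr)].
- apply/and4P; split; apply/forallP => r.
  + by rewrite ffunE /= cross0.
  + apply/forallP => c; apply/implyP => /andP[_]; rewrite ffunE /= => out.
    rewrite eqbF_neg; apply: contra out => cr.
    by apply/andP; split; [apply: ltn_ord | apply: cross_width].
  + rewrite ffunE /= ltn_ord /=.
    have -> : ord0 = inord 0 :> 'I_N.+1 by apply: val_inj; rewrite /= inordK.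
    by rewrite Q0 occupied_empty.
  + apply/forallP => c; apply/implyP => /andP[rc_v out].
    rewrite ffunE /= rc_v /= -occupied_lam -[r]inord_val.
    rewrite (chain_occupied_beyond chQ) // -1?ltnS // => r' le_rr' lt_r'N.
    apply: leq_trans (width_anti le_rr') _; rewrite leqNgt; apply: contra out => lt_c.
    by apply/andP; split; first exact: leq_ltn_trans lt_r'N.
apply/forallP => v; apply/implyP => v_in; rewrite state_of_weight_at //.
by case: crosses; [apply: spectral_neq0 | apply: oner_neq0].
Qed.

Lemma state_ofK Q : strip_chain Q -> chain_of_state (state_of Q) = Q.
Proof.
move=> chQ; have st := state_of_state chQ; apply/ffunP => r.
have le_rN : r <= N by rewrite -ltnS.
have [sp pc] := chain_of_state_spec st le_rN.
have sq := strip_chain_shape chQ le_rN; rewrite inord_val in sp pc sq.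
apply: (eq_shape sp sq) => c lt_c.
by rewrite pc // -[r]inord_val state_of_vertical.
Qed.

Lemma state_of_weight Q : strip_chain Q ->
  (state_weight x t (state_of Q) =
   \prod_(r < N) (if (r < n)%N then x' r else t' (r - n)%N) ^+
     \sum_(i < l) (part_of (Q (inord r.+1)) i - part_of (Q (inord r)) i))%R.
Proof.
move=> chQ; rewrite /state_weight.
transitivity (\prod_(v : 'I_N * 'I_C)
  (spectral x t v.1 ^+ crosses (Q (inord v.1)) (Q (inord v.1.+1)) v.2))%R.
  rewrite big_mkcond; apply: eq_bigr => v _.
  case: ifP => [v_in | ]; first exact: state_of_weight_at.
  move/negbT; rewrite /is_vertex ltn_ord -leqNgt => le_wc.
  by rewrite chain_crosses_beyond.
rewrite -(pair_bigA _ (fun (r : 'I_N) (c : 'I_C) =>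
  spectral x t r ^+ crosses (Q (inord r)) (Q (inord r.+1)) c)%R) /=.
apply: eq_bigr => r _; have [st sp sq] := strip_chain_step chQ (ltn_ord r).
by rewrite -sum_crosses // -spectralE expr_sum.
Qed.

Lemma partition_function_path_sum :
  partition_function x t =
  path_sum (vertex_kernel t' n x') (empty_shape l m) N lamS.
Proof.
rewrite strip_chain_sum /partition_function.
rewrite (reindex_onto state_of chain_of_state) => [|s /chain_of_stateK //].
apply: eq_big => [Q | Q].
  apply/andP/idP => [[st /eqP <-] | chQ]; first exact: chain_of_state_chain st.
  by rewrite state_of_state // state_ofK.
case/andP=> st /eqP QK; apply: state_of_weight.
by rewrite -QK; apply: chain_of_state_chain st.
Qed.

End Weights.

End VertexPaths.

(** * Comparison of the two path sums *)

Lemma partition_function_dual_grothendieck (R : comNzRingType) (n : nat) (lam : seq nat)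
    (x : 'I_n -> R) (t : 'I_(size lam).-1 -> R) : is_partition lam ->
  (forall i, x i != 0%R) -> (forall j, t j != 0%R) ->
  partition_function x t = dual_grothendieck x t.
Proof.
move=> lam_part x_neq0 t_neq0.
pose x' i := if insub i is Some j then x j else 0%R.
pose t' i := if insub i is Some j then t j else 0%R.
have xE i : x i = x' i by rewrite /x' valK.
have tE j : t j = t' j by rewrite /t' valK.
rewrite (partition_function_path_sum lam_part xE tE) //.
by rewrite (dual_grothendieck_path_sum lam_part xE tE) vertex_path_sum.
Qed.

Lemma mpolyX1_neq0 (R : comNzRingType) (k : nat) (i : 'I_k) :
  ('X_i : {mpoly R[k]})%R != 0%R.
Proof.
apply/eqP => X0; have := mcoeffXU R i i.
by rewrite X0 mcoeff0 eqxx => /esym/eqP; rewrite oner_eq0.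
Qed.

Theorem theorem3p8 (n : nat) (lam : seq nat) (lam_part : is_partition lam) :
  let x := fun i : 'I_n =>
    ('X_(lshift (size lam).-1 i) : {mpoly int[n + (size lam).-1]})%R in
  let t := fun j : 'I_(size lam).-1 =>
    ('X_(rshift n j) : {mpoly int[n + (size lam).-1]})%R in
  partition_function x t = dual_grothendieck x t.

Proof.
by move=> x t; apply: partition_function_dual_grothendieck => // i; apply: mpolyX1_neq0.
Qed.
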